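(* Let $\Omega$ be a set, let $F\subset\mathbb{R}$ be finite, and let $\mathcal A\subset F^\Omega$. Define $X_{\mathcal A}=\overline{\operatorname{span}}^{\,\|\cdot\|_\infty}\mathcal A\subset \ell_\infty(\Omega)$. Then the following assertions are equivalent: 1. $\mathcal A$ is finite; 2. $X_{\mathcal A}$ is finite-dimensional; 3. $X_{\mathcal A}$ is superreflexive; 4. $X_{\mathcal A}$ admits an equivalent uniformly convex norm. In particular, if $\mathcal A\subset F^\Omega$ is infinite (with $F$ finite), then $X_{\mathcal A}$ is not an infinite-dimensional superreflexive subspace of $\ell_\infty(\Omega)$.
   Context: All Banach spaces are real. $F^\Omega$ is the set of all functions $\Omega\to F$. $\ell_\infty(\Omega)$ is the Banach space of bounded real-valued functions on $\Omega$ with the norm $\|f\|_\infty=\sup_{\omega\in\Omega}|f(\omega)|$; $X_{\mathcal A}$ is the norm-closed real linear span of $\mathcal A$ in it, equipped with this norm. A Banach space $Y$ is finitely representable in a Banach space $X$ if for every finite-dimensional subspace $E\subseteq Y$ and every $\varepsilon>0$ there exist a finite-dimensional subspace $G\subseteq X$ and an isomorphism $T:E\to G$ with $\|T\|\,\|T^{-1}\|<1+\varepsilon$. A Banach space $X$ is superreflexive if every Banach space finitely representable in $X$ is reflexive. *)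

(* Defs.v *)
From HB Require Import structures.
From mathcomp Require Import all_boot all_order all_algebra.
From mathcomp Require Import all_classical all_reals all_analysis.

Set Implicit Arguments.
Unset Strict Implicit.
Unset Printing Implicit Defensive.

Import Order.TTheory GRing.Theory Num.Theory.
Import numFieldNormedType.Exports.

Local Open Scope classical_set_scope.
Local Open Scope ring_scope.

Definition linear_span (R : realType) (V : lmodType R) (S : set V) : set V :=
  [set v | exists (n : nat) (x : 'I_n -> V) (c : 'I_n -> R),
    (forall i, S (x i)) /\ v = \sum_(i < n) c i *: x i].

(* Such a set E is a linear subspace of V; the whole space V is
   finite-dimensional when [set: V] is. *)
Definition finite_dimensional (R : realType) (V : lmodType R) (E : set V) :=
  exists S : set V, finite_set S /\ E = linear_span S.

Section linear_span_theory.
Context (R : realType) (V : lmodType R).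
Implicit Types S : set V.

Lemma sub_linear_span S : S `<=` linear_span S.
Proof.
move=> v Sv; exists 1%N, (fun=> v), (fun=> 1); split => //.
by rewrite big_ord1 scale1r.
Qed.

Lemma linear_span0 S : linear_span S 0.
Proof.
exists 0%N, (fun=> 0), (fun=> 0); split => [[]//|].
by rewrite big_ord0.
Qed.

Lemma linear_spanP S (a : R) (u v : V) :
  linear_span S u -> linear_span S v -> linear_span S (a *: u + v).
Proof.
move=> [n [x [c [Sx ->]]]] [m [y [d [Sy ->]]]].
exists (n + m)%N, (fun i : 'I_(n + m) => match fintype.split i with inl j => x j | inr j => y j end),
  (fun i : 'I_(n + m) => match fintype.split i with inl j => a * c j | inr j => d j end); split.
  by move=> i; case: (fintype.split i).
rewrite big_split_ord /= scaler_sumr; congr +%R; apply: eq_bigr => i _.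
  by rewrite (unsplitK (inl i)) scalerA.
by rewrite (unsplitK (inr i)).
Qed.

End linear_span_theory.

(* Norm of T restricted to the subspace E. The library's sup of an unbounded set
   is 0, so this is meaningful only when T is bounded on the unit ball of E; that
   holds in both uses below, namely for continuous functionals and for linear
   maps on finite-dimensional subspaces. *)
Definition opnorm (R : realType) (V W : normedModType R) (E : set V)
    (T : V -> W) : R :=
  sup [set `|T x| | x in [set x | E x /\ `|x| <= 1]].

Definition linear_on (R : realType) (V W : lmodType R) (E : set V)
    (T : V -> W) :=
  forall (a : R) (x y : V), E x -> E y -> T (a *: x + y) = a *: T x + T y.

Section dual.
Context (R : realType) (V : normedModType R).

Definition dual_pred : {pred V -> R} :=
  mem [set f : V -> R | linear f /\ continuous f].

(* The topological dual of V, normed below by opnorm setT. *)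
Record dual := Dual { dual_fun :> V -> R; _ : dual_fun \in dual_pred }.

HB.instance Definition _ := [isSub for dual_fun].
HB.instance Definition _ := [Choice of dual by <:].

Lemma dual_submod_closed : submod_closed dual_pred.
Proof.
split; first by rewrite inE; split => [a x y|x];
  [rewrite /= /GRing.zero /= scaler0 addr0|exact: cst_continuous].
move=> a f g; rewrite !inE => -[lf cf] [lg cg]; split => [b x y|x].
  rewrite !fctE lf lg !scalerDr !scalerA (mulrC a b) -!addrA; congr +%R.
  by rewrite addrCA.
apply: continuousD; last exact: cg.
by apply: continuousM; [exact: cst_continuous|exact: cf].
Qed.

HB.instance Definition _ :=
  GRing.isSubmodClosed.Build _ _ dual_pred dual_submod_closed.
HB.instance Definition _ := [SubChoice_isSubLmodule of dual by <:].


Lemma dualP (f : dual) : linear f /\ continuous f.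
Proof. by have := valP f; rewrite inE. Qed.

Lemma dual_linear (f : dual) : linear f. Proof. by case: (dualP f). Qed.

Lemma dual_continuous (f : dual) : continuous f.
Proof. by case: (dualP f). Qed.

Let dual_has_sup (f : dual) :
  has_sup [set `|f x| | x in [set x | setT x /\ `|x| <= 1]].
Proof.
split; first by exists `|f 0|, 0 => //=; rewrite normr0 ler01.
pose F : {linear V -> R} :=
  HB.pack (f : V -> R) (GRing.isLinear.Build _ _ _ _ _ (dual_linear f)).
have [M fM] : exists M, forall x, `|x| <= 1 -> `|F x| <= M.
  have /bounded_funP : bounded_near F (nbhs (0 : V)); last exact.
  by apply: continuous_linear_bounded; exact: dual_continuous.
by exists M => _ [x [_ x1] <-]; exact: fM.
Qed.

Let dual0 (f : dual) : f 0 = 0.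
Proof.
by have := dual_linear f (-1) 0 0; rewrite scaler0 add0r scaleN1r addNr.
Qed.

Let dualZ (f : dual) a x : f (a *: x) = a * f x.
Proof. by have := dual_linear f a x 0; rewrite !addr0 dual0 addr0. Qed.

Lemma dual_le (f : dual) (x : V) : `|f x| <= opnorm setT f * `|x|.
Proof.
have [->|x0] := eqVneq x 0; first by rewrite dual0 !normr0 mulr0.
have nx0 : 0 < `|x| by rewrite normr_gt0.
rewrite -ler_pdivrMr// mulrC -[X in X * _]gtr0_norm ?invr_gt0//.
rewrite -normrM -dualZ; apply: ub_le_sup; first exact: (dual_has_sup f).2.
exists (`|x|^-1 *: x) => //=; split=> //.
by rewrite normrZ gtr0_norm ?invr_gt0// mulVf// gt_eqF.
Qed.

Let ball_nonempty (f : V -> R) :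
  [set `|f x| | x in [set x | setT x /\ `|x| <= 1]] !=set0.
Proof. by exists `|f 0|, 0 => //=; rewrite normr0 ler01. Qed.

Let dual_normD (f g : dual) :
  opnorm setT (f + g) <= opnorm setT f + opnorm setT g.
Proof.
apply: ge_sup => // _ [x [_ x1] <-].
rewrite (le_trans (ler_normD _ _))// lerD//.
- by apply: ub_le_sup; [exact: (dual_has_sup f).2|exists x].
- by apply: ub_le_sup; [exact: (dual_has_sup g).2|exists x].
Qed.

Let dual_norm_ge0 (f : dual) : 0 <= opnorm setT f.
Proof.
apply: ub_le_sup; first exact: (dual_has_sup f).2.
by exists 0; [rewrite /= normr0 ler01|rewrite dual0 normr0].
Qed.

Let dual_normZ (a : R) (f : dual) :
  opnorm setT (a *: f) = `|a| * opnorm setT f.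
Proof.
apply/eqP; rewrite eq_le; apply/andP; split.
  apply: ge_sup => // _ [x [_ x1] <-].
  rewrite normrM ler_wpM2l//.
  by apply: ub_le_sup; [exact: (dual_has_sup f).2|exists x].
have [->|a0] := eqVneq a 0; first by rewrite normr0 mul0r.
rewrite mulrC -ler_pdivlMr ?normr_gt0//.
apply: ge_sup => // _ [x [_ x1] <-].
rewrite ler_pdivlMr ?normr_gt0// mulrC -normrM.
by apply: ub_le_sup; [exact: (dual_has_sup (a *: f)).2|exists x].
Qed.

Let dual_norm_eq0 (f : dual) : opnorm setT f = 0 -> f = 0.
Proof.
move=> f0; apply/val_inj/funext => x; apply/eqP; rewrite -normr_le0.
by rewrite (le_trans (dual_le f x))// f0 mul0r.
Qed.

HB.instance Definition _ := Lmodule_isNormed.Build R dual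
  dual_normD dual_normZ dual_norm_eq0.

Lemma dual_normE (f : dual) : `|f| = opnorm setT f. Proof. by []. Qed.

End dual.
Arguments dual_pred {R} V.

Section bidual_embedding.
Context (R : realType) (X : normedModType R).

Let eval_bidual (x : X) : (fun f : dual X => f x) \in dual_pred (dual X).
Proof.
rewrite inE; split=> [//|f].
have evl : linear (fun f : dual X => f x) by [].
pose F : {linear dual X -> R} :=
  HB.pack (fun f : dual X => f x) (GRing.isLinear.Build _ _ _ _ _ evl).
apply: (@bounded_linear_continuous _ _ _ F).
apply/bounded_funP => r; exists (r * `|x|) => g gr.
by rewrite (le_trans (dual_le g x))// ler_wpM2r// -dual_normE.
Qed.

Definition bidual_embedding (x : X) : dual (dual X) := Dual (eval_bidual x).

End bidual_embedding.

Definition reflexive_space (R : realType) (X : completeNormedModType R) :=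
  forall phi : dual (dual X), exists x : X, bidual_embedding x = phi.

(* T is an isomorphism from E onto G, and T' its inverse. The values of T off E
   and of T' off G are irrelevant. *)
Definition finitely_representable (R : realType)
    (Y X : completeNormedModType R) :=
  forall (E : set Y) (eps : R), finite_dimensional E -> 0 < eps ->
  exists (G : set X) (T : Y -> X) (T' : X -> Y),
    [/\ finite_dimensional G, linear_on E T, set_bij E G T,
        forall x, E x -> T' (T x) = x & opnorm E T * opnorm G T' < 1 + eps].

Definition superreflexive (R : realType) (X : completeNormedModType R) :=
  forall Y : completeNormedModType R,
    finitely_representable Y X -> reflexive_space Y.

Definition is_norm (R : realType) (V : lmodType R) (N : V -> R) :=
  [/\ forall x y, N (x + y) <= N x + N y,
      forall (a : R) x, N (a *: x) = `|a| * N x &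
      forall x, N x = 0 -> x = 0].

Definition equivalent_norm (R : realType) (X : normedModType R) (N : X -> R) :=
  is_norm N /\ exists c C : R,
    [/\ 0 < c, 0 < C & forall x, c * `|x| <= N x <= C * `|x|].

Definition uniformly_convex (R : realType) (V : lmodType R) (N : V -> R) :=
  forall eps : R, 0 < eps -> exists2 delta : R, 0 < delta &
    forall x y, N x = 1 -> N y = 1 -> eps <= N (x - y) ->
      N (2^-1 *: (x + y)) <= 1 - delta.

Section linfty.
Context (R : realType) (Omega : Type).

Definition linfty_pred : {pred Omega -> R} := mem [set f : Omega -> R |
  exists M, forall w, `|f w| <= M].

Record linfty := Linfty {
  linfty_fun :> Omega -> R; _ : linfty_fun \in linfty_pred }.

HB.instance Definition _ := [isSub for linfty_fun].
HB.instance Definition _ := [Choice of linfty by <:].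

Lemma linfty_submod_closed : submod_closed linfty_pred.
Proof.
split; first by rewrite inE; exists 0 => w; rewrite normr0.
move=> a f g; rewrite !inE => -[M fM] [N gN]; exists (`|a| * M + N) => w.
by rewrite (le_trans (ler_normD _ _))// lerD// normrM ler_wpM2l.
Qed.

HB.instance Definition _ :=
  GRing.isSubmodClosed.Build _ _ linfty_pred linfty_submod_closed.
HB.instance Definition _ := [SubChoice_isSubLmodule of linfty by <:].

(* The supremum of the empty set is 0, so that this is also the expected norm
   when Omega is empty. *)
Definition linfty_norm (f : linfty) : R := sup (range (fun w => `|f w|)).

Let linfty_bound (f : linfty) : has_ubound (range (fun w => `|f w|)).
Proof.
by have := valP f; rewrite inE => -[M fM]; exists M => _ [w _ <-]; exact: fM.
Qed.

Lemma le_linfty_norm (f : linfty) w : `|f w| <= linfty_norm f.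
Proof. by apply: ub_le_sup; [exact: linfty_bound|exists w]. Qed.

Lemma linfty_norm_ge0 (f : linfty) : 0 <= linfty_norm f.
Proof.
have [/set0P[_ [w _ _]]|/negPn/eqP f0] := boolP (range (fun w => `|f w|) != set0).
  exact: le_trans (le_linfty_norm f w).
by rewrite /linfty_norm f0 sup0.
Qed.

Lemma linfty_norm_le (f : linfty) (M : R) :
  0 <= M -> (forall w, `|f w| <= M) -> linfty_norm f <= M.
Proof.
move=> M0 fM.
have [/set0P f0|/negPn/eqP f0] := boolP (range (fun w => `|f w|) != set0).
  by apply: ge_sup => // _ [w _ <-].
by rewrite /linfty_norm f0 sup0.
Qed.

Let linfty_normD (f g : linfty) :
  linfty_norm (f + g) <= linfty_norm f + linfty_norm g.
Proof.
apply: linfty_norm_le => [|w]; first by rewrite addr_ge0 ?linfty_norm_ge0.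
by rewrite (le_trans (ler_normD _ _))// lerD ?le_linfty_norm.
Qed.

Let linfty_normZ (a : R) (f : linfty) :
  linfty_norm (a *: f) = `|a| * linfty_norm f.
Proof.
apply/eqP; rewrite eq_le; apply/andP; split.
  apply: linfty_norm_le => [|w]; first by rewrite mulr_ge0 ?linfty_norm_ge0.
  by rewrite normrM ler_wpM2l ?le_linfty_norm.
have [->|a0] := eqVneq a 0; first by rewrite normr0 mul0r linfty_norm_ge0.
rewrite mulrC -ler_pdivlMr ?normr_gt0//.
apply: linfty_norm_le => [|w]; first by rewrite divr_ge0 ?linfty_norm_ge0.
by rewrite ler_pdivlMr ?normr_gt0// mulrC -normrM (le_linfty_norm (a *: f)).
Qed.

Let linfty_norm_eq0 (f : linfty) : linfty_norm f = 0 -> f = 0.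
Proof.
move=> f0; apply/val_inj/funext => w; apply/eqP; rewrite -normr_le0.
by rewrite -f0 le_linfty_norm.
Qed.

HB.instance Definition _ := Lmodule_isNormed.Build R linfty
  linfty_normD linfty_normZ linfty_norm_eq0.

Lemma linfty_normE (f : linfty) : `|f| = sup (range (fun w => `|f w|)).
Proof. by []. Qed.

Let linfty_complete (F : set_system linfty) :
  ProperFilter F -> cauchy F -> cvg F.
Proof.
move=> FF /cauchyP F_cauchy.
have ev_cvg w : cvg ((f : linfty) w @[f --> F]).
  apply: cauchy_cvg; apply: cauchy_exP => e e0.
  have [f Ff] := F_cauchy _ e0; exists (f w).
  apply: (@filterS _ F _ (ball f e)) Ff => g.
  rewrite -!ball_normE/=; apply: le_lt_trans.
  exact: (le_linfty_norm (f - g)).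
pose g w := lim ((f : linfty) w @[f --> F]).
have gE e : 0 < e -> exists2 f : linfty, F (ball f e) & forall w, `|f w - g w| <= e.
  move=> e0; have [f Ff] := F_cauchy _ e0; exists f => // w.
  have /cvgrPdist_le/= gw := ev_cvg w.
  apply/ler_addgt0Pr => d d0.
  have [h [fh gh]] := filter_ex (filterI Ff (gw _ d0)).
  rewrite -(subrKA (h w)) (le_trans (ler_normD _ _))// lerD//.
    rewrite -ball_normE/= in fh; apply: le_trans (ltW fh).
    exact: (le_linfty_norm (f - h)).
  by rewrite distrC.
have gP : g \in linfty_pred.
  have [f _ fg] := gE _ ltr01; rewrite inE; exists (linfty_norm f + 1) => w.
  rewrite -[g w](subKr (f w)) (le_trans (ler_normB _ _))// lerD//.
  exact: le_linfty_norm.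
apply/cvg_ex; exists (Linfty gP); apply/cvgrPdist_le => e e0.
have e20 : 0 < e / 2 by rewrite divr_gt0.
have [f Ff fg] := gE _ e20.
apply: filterS Ff => h; rewrite -ball_normE/= => fh.
rewrite -(subrKA f) (le_trans (ler_normD _ _))// (splitr e) lerD ?(ltW fh)//.
by rewrite distrC; apply: linfty_norm_le => //; exact: ltW.
Qed.

HB.instance Definition _ := Uniform_isComplete.Build linfty linfty_complete.

End linfty.

Section closed_span.
Context (R : realType) (V : completeNormedModType R) (S : set V).

Definition closed_span_pred : {pred V} := mem (closure (linear_span S)).

Record closed_span := ClosedSpan {
  closed_span_val :> V; _ : closed_span_val \in closed_span_pred }.

HB.instance Definition _ := [isSub for closed_span_val].
HB.instance Definition _ := [Choice of closed_span by <:].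

Lemma closed_span_submod_closed : submod_closed closed_span_pred.
Proof.
split; first by rewrite inE; apply: subset_closure; exact: linear_span0.
move=> a u v; rewrite !inE => cu cv B.
have cont : (a *: z.1 + z.2) @[z --> (u, v)] --> a *: u + v.
  apply: cvgD; last exact: cvg_snd.
  by apply: cvgZr; exact: cvg_fst.
move=> /cont[[B1 B2] /= [uB1 vB2] B12B].
have [u' [Su' B1u']] := cu _ uB1.
have [v' [Sv' B2v']] := cv _ vB2.
exists (a *: u' + v'); split; first exact: linear_spanP.
exact: (B12B (u', v')).
Qed.

HB.instance Definition _ :=
  GRing.isSubmodClosed.Build _ _ closed_span_pred closed_span_submod_closed.
HB.instance Definition _ := [SubChoice_isSubLmodule of closed_span by <:].

Definition closed_span_norm (x : closed_span) : R := `|val x|.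

Let closed_span_normD (x y : closed_span) :
  closed_span_norm (x + y) <= closed_span_norm x + closed_span_norm y.
Proof. exact: ler_normD. Qed.

Let closed_span_normZ (a : R) (x : closed_span) :
  closed_span_norm (a *: x) = `|a| * closed_span_norm x.
Proof. exact: normrZ. Qed.

Let closed_span_norm_eq0 (x : closed_span) : closed_span_norm x = 0 -> x = 0.
Proof. by move=> /normr0_eq0 x0; exact: val_inj. Qed.

HB.instance Definition _ := Lmodule_isNormed.Build R closed_span
  closed_span_normD closed_span_normZ closed_span_norm_eq0.

Lemma closed_span_normE (x : closed_span) : `|x| = `|val x|.
Proof. by []. Qed.

Let closed_span_complete (F : set_system closed_span) :
  ProperFilter F -> cauchy F -> cvg F.
Proof.
move=> FF /cauchyP F_cauchy.
have Fv : cvg (val x @[x --> F]).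
  apply: cauchy_cvg; apply: cauchy_exP => e e0.
  have [x Fx] := F_cauchy _ e0; exists (val x).
  by apply: (@filterS _ F _ (ball x e)) Fx => y; rewrite -!ball_normE.
have lP : lim (val x @[x --> F]) \in closed_span_pred.
  rewrite inE; apply: (closed_cvg _ _ _ _ Fv); first exact: closed_closure.
  by apply: nearW => x; have := valP x; rewrite inE.
apply/cvg_ex; exists (ClosedSpan lP); apply/cvgrPdist_le => e e0.
by move/cvgrPdist_le : Fv => /(_ _ e0).
Qed.

HB.instance Definition _ :=
  Uniform_isComplete.Build closed_span closed_span_complete.

End closed_span.

Lemma finite_valued_linfty (R : realType) (Omega : Type) (F : set R)
    (f : Omega -> R) :
  finite_set F -> (forall w, F (f w)) -> f \in @linfty_pred R Omega.
Proof.
move=> finF fF; rewrite inE.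
have /finite_seqP[X XE] : finite_set [set `|x| | x in F].
  exact: finite_image.
exists (\sum_(y <- X) y) => w.
have wX : `|f w| \in X.
  have : [set `|x| | x in F] `|f w| by exists (f w).
  by rewrite XE.
rewrite (big_rem _ wX)/= lerDl big_seq sumr_ge0// => y /mem_rem yX.
have : [set` X] y by [].
by rewrite -XE => -[x _ <-].
Qed.

(* The closed span is taken in the Banach space linfty; when the functions in A
   have values in a fixed finite set, finite_valued_linfty shows that all of
   them belong to that space. *)
Definition XA (R : realType) (Omega : Type) (A : set (Omega -> R)) :
    completeNormedModType R :=
  closed_span [set f : linfty R Omega | A f].

(* Main.v *)
From HB Require Import structures.
Require Import Defs.
From mathcomp Require Import all_boot all_order all_algebra lra ring.
From mathcomp Require Import all_classical all_reals all_analysis.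

Set Implicit Arguments.
Unset Strict Implicit.
Unset Printing Implicit Defensive.

Import Order.TTheory GRing.Theory Num.Theory.
Import numFieldNormedType.Exports.

Local Open Scope classical_set_scope.
Local Open Scope ring_scope.

(** If A is finite, X_A is the span of A, because finite-dimensional subspaces
    are closed; such a space carries an equivalent Euclidean norm, which is
    uniformly convex, and any space finitely representable in it has at most
    its dimension, hence is reflexive. So everything reduces to an infinite A,
    for which two things are needed: a non-reflexive space finitely
    representable in X_A, and the absence of uniformly convex renormings.

    Take distinct members f_0, f_1, ... of A and a free ultrafilter U on nat.
    Call a word s_1 ... s_n over F a pattern if, for U-almost every i_1, for
    U-almost every i_2, and so on, some point w has f_{i_j}(w) = s_j for all j.
    The patterns of length n are exactly the value vectors taken by some
    f_{i_1}, ..., f_{i_n} ([pattern_realized]); they are closed under passing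
    to subwords, and a letter can be inserted at any place ([pattern_insert]).
    Let Omega' be the set of infinite words all of whose prefixes are patterns,
    and Y the closed span in l^oo(Omega') of the coordinates e_0, e_1, ...
    Then e_0, ..., e_(n-1) are isometric to f_{i_1}, ..., f_{i_n}
    ([pattern_space_isometric_copies]), and a perturbation argument makes Y
    finitely representable in X_A. (Y is a spreading model of the f_i, and U
    does the work of Ramsey's theorem.)

    As the f_i are distinct, some word ab with a <> b is a pattern. Inserting
    many letters on both sides and keeping only equal ones gives patterns
    u ... u a b v ... v. If u <> v, all words u^m v^m are patterns. Otherwise
    all words u^m c u^m are patterns for some c <> u, and one may assume that no
    word x^K y^K with x <> y is a pattern, for some fixed K
    ([pattern_dichotomy]); then every point of Omega' differs from a constant
    word at a bounded number of places, so that the partial sums of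
    sum_j (e_(2j) - e_(2j+1)) are bounded. In the first case the e_i, in the
    second case these partial sums form a ladder: a bounded sequence x_i and
    points w_k -> w_oo of Omega' with x_i(w_k) = alpha for i < k and
    x_i(w_k) = beta <> alpha for k <= i ([pattern_space_ladder]).

    A ladder excludes reflexivity: a weak limit y of the x_i would have
    y(w_k) = beta and y(w_oo) = alpha, although every element of Y is
    continuous along w_k -> w_oo ([ladder_not_reflexive]). Copied into X_A,
    it also excludes uniformly convex norms: the means of consecutive
    blocks of length 2^j of a ladder form a dyadic tree of bounded vectors whose
    siblings are uniformly separated, whereas for a uniformly convex norm each
    averaging of separated vectors of a tree loses a fixed proportion of the
    norm ([uniformly_convex_no_tree], [ladder_not_uniformly_convex]). *)

(** * Finite-dimensional spaces *)

Section lincomb.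
Context (R : realType) (V : lmodType R).

Definition lincomb n (b : 'I_n -> V) (c : 'I_n -> R) : V :=
  \sum_(i < n) c i *: b i.

Definition lin_indep n (b : 'I_n -> V) :=
  forall c : 'I_n -> R, lincomb b c = 0 -> forall i, c i = 0.

Lemma lincombP n (b : 'I_n -> V) a c d :
  lincomb b (fun i => a * c i + d i) = a *: lincomb b c + lincomb b d.
Proof.
rewrite /lincomb scaler_sumr -big_split; apply: eq_bigr => i _.
by rewrite scalerDl scalerA.
Qed.

Lemma lincombB n (b : 'I_n -> V) c d :
  lincomb b (fun i => c i - d i) = lincomb b c - lincomb b d.
Proof.
by rewrite /lincomb -sumrB; apply: eq_bigr => i _; rewrite scalerBl.
Qed.

Lemma lincombZ n (b : 'I_n -> V) a c :
  lincomb b (fun i => a * c i) = a *: lincomb b c.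
Proof.
by rewrite /lincomb scaler_sumr; apply: eq_bigr => i _; rewrite scalerA.
Qed.

Lemma lincomb0 n (b : 'I_n -> V) : lincomb b (fun=> 0) = 0.
Proof. by rewrite /lincomb big1 // => i _; rewrite scale0r. Qed.

Lemma lincomb_unit n (b : 'I_n -> V) i :
  lincomb b (fun j => (j == i)%:R) = b i.
Proof.
rewrite /lincomb (bigD1 i) //= eqxx scale1r big1 ?addr0 // => j /negPf ->.
by rewrite scale0r.
Qed.

Lemma eq_lincomb n (b : 'I_n -> V) c d : c =1 d -> lincomb b c = lincomb b d.
Proof. by move=> cd; apply: eq_bigr => i _; rewrite cd. Qed.

Lemma lincomb_sum n m (b : 'I_n -> V) (C : 'I_m -> 'I_n -> R) (c : 'I_m -> R) :
  lincomb (fun i => lincomb b (C i)) c =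
  lincomb b (fun j => \sum_(i < m) c i * C i j).
Proof.
rewrite /lincomb; under eq_bigr do rewrite scaler_sumr.
rewrite exchange_big /=; apply: eq_bigr => j _.
by rewrite scaler_suml; apply: eq_bigr => i _; rewrite scalerA.
Qed.

Lemma lin_indep_inj n (b : 'I_n -> V) c d :
  lin_indep b -> lincomb b c = lincomb b d -> c = d.
Proof.
move=> fb cd; apply/funext => i; apply/eqP; rewrite -subr_eq0; apply/eqP.
by apply: (fb (fun i => c i - d i)); rewrite lincombB cd subrr.
Qed.

Lemma linear_span_range n (b : 'I_n -> V) :
  linear_span (range b) = range (lincomb b).
Proof.
apply/seteqP; split=> [v [m [x [c [bx ->]]]]|_ [c _ <-]]; last first.
  by exists n, b, c; split => // i; exists i.
have /choice[g xg] : forall i, exists j, b j = x i.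
  by move=> i; have [j _ <-] := bx i; exists j.
exists (fun j => \sum_(i < m) c i * (j == g i)%:R) => //.
rewrite -lincomb_sum; apply: eq_bigr => i _.
by rewrite lincomb_unit xg.
Qed.

Lemma finite_dimensional_range n (b : 'I_n -> V) :
  finite_dimensional (range (lincomb b)).
Proof.
exists (range b); split; last by rewrite linear_span_range.
exact: finite_image finite_finset.
Qed.

Lemma finite_range (S : set V) :
  finite_set S -> exists n (b : 'I_n -> V), S = range b.
Proof.
move=> /finite_seqP[s ->]; exists (size s), (fun i => s`_i).
apply/seteqP; split=> [x /= xs|_ [i _ <-]]; last exact: mem_nth.
have xi : (index x s < size s)%N by rewrite index_mem.
by exists (Ordinal xi) => //=; rewrite nth_index.
Qed.

(** As long as a spanning family is dependent, one of its members can be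
    dropped. *)
Lemma finite_dimensional_basis (E : set V) : finite_dimensional E ->
  exists n (b : 'I_n -> V), lin_indep b /\ E = range (lincomb b).
Proof.
move=> [S [/finite_range[m [b ->]] ->]]; rewrite linear_span_range.
elim: m b => [|m IH] b; first by exists 0%N, b; split=> // c _ [].
have [fb|nfb] := pselect (lin_indep b); first by exists m.+1, b.
move/existsNP : nfb => [c /not_implyP[bc0 /existsNP[i /eqP ci0]]].
have [n [b' [fb' bb']]] := IH (fun j => b (lift i j)).
exists n, b'; split=> //; rewrite -bb' {n b' fb' bb' IH}.
have bi : b i = - \sum_(j < m) (c (lift i j) / c i) *: b (lift i j).
  apply: (scalerI ci0); apply/eqP; rewrite scalerN -subr_eq0 opprK; apply/eqP.
  rewrite -[RHS]bc0 /lincomb (bigD1_ord i) //=; congr +%R.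
  rewrite scaler_sumr; apply: eq_bigr => j _.
  by rewrite scalerA mulrC divfK.
apply/seteqP; split=> _ [d _ <-].
  exists (fun j => d (lift i j) - d i * (c (lift i j) / c i)) => //.
  by rewrite lincombB lincombZ /lincomb (bigD1_ord i) //= bi scalerN addrC.
exists (fun j => oapp d 0 (unlift i j)) => //.
rewrite /lincomb (bigD1_ord i) //= unlift_none /= scale0r add0r.
by apply: eq_bigr => j _; rewrite liftK.
Qed.

Lemma lin_indep_card m n (x : 'I_m -> V) (b : 'I_n -> V) :
  lin_indep x -> (forall i, range (lincomb b) (x i)) -> (m <= n)%N.
Proof.
move=> fx xb.
have /choice[C xC] : forall i, exists c, x i = lincomb b c.
  by move=> i; have [c _ <-] := xb i; exists c.
rewrite leqNgt; apply/negP => nm.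
pose M := \matrix_(i < m, j < n) C i j.
have : kermx M != 0.
  rewrite -mxrank_eq0 mxrank_ker -lt0n subn_gt0.
  exact: leq_ltn_trans (rank_leq_col _) nm.
move=> /rowV0Pn[u /sub_kermxP uM /eqP]; apply; apply/rowP => i.
rewrite mxE; apply: (fx (fun i => u 0 i)).
rewrite (_ : x = fun i => lincomb b (C i)); last exact/funext.
rewrite lincomb_sum -[RHS](lincomb0 b); apply: eq_lincomb => j /=.
transitivity ((u *m M) 0 j); last by rewrite uM mxE.
by rewrite mxE; apply: eq_bigr => k _; rewrite mxE.
Qed.

Definition extend_family n (b : 'I_n -> V) v (i : 'I_n.+1) : V :=
  oapp b v (unlift ord_max i).

Lemma lincomb_extend n (b : 'I_n -> V) v c :
  lincomb (extend_family b v) c =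
  c ord_max *: v + lincomb b (fun i => c (lift ord_max i)).
Proof.
rewrite /lincomb (bigD1_ord ord_max) //= /extend_family unlift_none /=.
by under eq_bigr do rewrite liftK /=.
Qed.

Lemma lin_indep_extend n (b : 'I_n -> V) v :
  lin_indep b -> ~ range (lincomb b) v -> lin_indep (extend_family b v).
Proof.
move=> fb nv c; rewrite lincomb_extend => c0.
have cm0 : c ord_max = 0.
  apply: contrapT => /eqP cm; apply: nv.
  exists (fun i => - (c ord_max)^-1 * c (lift ord_max i)) => //.
  rewrite lincombZ; apply: (scalerI cm); rewrite scalerA mulrN divff //.
  by apply/eqP; rewrite scaleN1r eq_sym -addr_eq0 c0.
move: c0; rewrite cm0 scale0r add0r => /fb cl i.
by case: (unliftP ord_max i) => [j|] ->.
Qed.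

(** An independent family of greatest size spans, by [lin_indep_extend]. *)
Lemma bounded_lin_indep_finite_dimensional (N : nat) :
  (forall n (b : 'I_n -> V), lin_indep b -> (n <= N)%N) ->
  finite_dimensional [set: V].
Proof.
move=> bnd.
pose P n := `[< exists b : 'I_n -> V, lin_indep b >].
have P0 : exists n, P n by exists 0%N; apply/asboolP; exists (fun=> 0) => ? _ [].
have PN n : P n -> (n <= N)%N by move=> /asboolP[b /bnd].
case: (ex_maxnP P0 PN) => n /asboolP[b fb] nmax.
suff -> : [set: V] = range (lincomb b) by exact: finite_dimensional_range.
apply/seteqP; split=> // v _; apply: contrapT => nv.
suff /asboolP/nmax : exists b' : 'I_n.+1 -> V, lin_indep b' by rewrite ltnn.
by exists (extend_family b v); exact: lin_indep_extend.
Qed.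

End lincomb.

(** The norm of the combination is a continuous nonvanishing function of the
    coefficients, so it has a positive minimum on the compact l^1 unit
    sphere. *)
Lemma lin_indep_lower_bound (R : realType) (V : normedModType R) n
    (b : 'I_n -> V) : lin_indep b ->
  exists2 k : R, 0 < k & forall c, k * \sum_(i < n) `|c i| <= `|lincomb b c|.
Proof.
case: n b => [|n] b fb.
  by exists 1 => // c; rewrite big_ord0 mulr0.
pose S := [set t : 'rV[R]_n.+1 | \sum_(i < n.+1) `|t ord0 i| = 1].
pose g (t : 'rV[R]_n.+1) := `|lincomb b (fun i => t ord0 i)|.
have coef i : continuous (fun t : 'rV[R]_n.+1 => t ord0 i).
  exact: coord_continuous.
have S0 : S !=set0.
  exists (\row_i (i == ord0)%:R); rewrite /S /= (bigD1 ord0) //=.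
  rewrite mxE eqxx normr1 big1 ?addr0 // => i /negPf i0.
  by rewrite mxE i0 normr0.
pose l1 (t : 'rV[R]_n.+1) := \sum_(i < n.+1) `|t ord0 i|.
have l1_continuous : continuous l1.
  apply: continuous_big => [|i _ t]; first exact: add_continuous.
  exact: cvg_norm (coef i t).
have cS : compact S.
  apply: bounded_closed_compact.
    exists 1; split=> // M M1 t St; apply: le_trans (ltW M1).
    rewrite /Num.norm /= mx_normrE; apply/bigmax_leP; split => // -[i j] _ /=.
    rewrite -[X in _ <= X]St (ord1 i) (bigD1 j) //= lerDl.
    by apply: sumr_ge0 => k _; exact: normr_ge0.
  rewrite (_ : S = l1 @^-1` [set 1]) //.
  apply: preimage_closed; last exact: closed_eq.
  by move=> t _; exact: l1_continuous.
have cg : continuous g.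
  have cl : continuous (fun t : 'rV[R]_n.+1 => lincomb b (fun i => t ord0 i)).
    apply: continuous_big => [|i _ t]; first exact: add_continuous.
    exact: cvgZr_tmp (coef i t).
  by move=> t; exact: cvg_norm (cl t).
have [t0 t0S t0min] := compact_EVT_min S0 cS (continuous_subspaceT cg).
rewrite inE in t0S.
have gt0 : 0 < g t0.
  rewrite normr_gt0; apply/eqP => /fb t00.
  move: t0S; rewrite /S /= big1 => [/eqP|i _]; last by rewrite t00 normr0.
  by rewrite eq_sym oner_eq0.
exists (g t0) => // c; set s := \sum_(i < _) _.
have s0 : 0 <= s by apply: sumr_ge0.
have [->|sn0] := eqVneq s 0; first by rewrite mulr0.
have {s0 sn0}s_gt0 : 0 < s by rewrite lt_def sn0.
rewrite -ler_pdivlMr //.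
have := t0min (\row_i (s^-1 * c i)); rewrite inE /S /=.
have -> : \sum_(i < n.+1) `|(\row_i0 (s^-1 * c i0)) ord0 i| = 1.
  under eq_bigr do rewrite mxE normrM gtr0_norm ?invr_gt0//.
  by rewrite -mulr_sumr mulVf // gt_eqF.
move=> /(_ erefl)/le_trans; apply; rewrite /g.
rewrite (@eq_lincomb _ _ _ _ _ (fun i => s^-1 * c i)); last by move=> i; rewrite mxE.
by rewrite lincombZ normrZ gtr0_norm ?invr_gt0// mulrC.
Qed.

(** Extending a basis by a vector outside the span keeps it independent, so
    [lin_indep_lower_bound] puts the vector at positive distance from the
    span. *)
Lemma finite_dimensional_closed (R : realType) (V : normedModType R)
    (E : set V) : finite_dimensional E -> closed E.
Proof.
move=> /finite_dimensional_basis[n [b [fb ->]]] v cv.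
apply: contrapT => nv.
have fb' := lin_indep_extend fb nv.
have [k k0 kb] := lin_indep_lower_bound fb'.
have [_ [[c _ <-]]] := cv _ (nbhsx_ballx v k k0).
rewrite -ball_normE /= => cvk.
have := kb (fun i => oapp (fun i => - c i) 1 (unlift ord_max i)).
rewrite lincomb_extend unlift_none /= scale1r.
rewrite (@eq_lincomb _ _ _ _ _ (fun i => -1 * c i)); last first.
  by move=> i; rewrite liftK /= mulN1r.
rewrite lincombZ scaleN1r => /le_lt_trans/(_ cvk).
rewrite (bigD1_ord ord_max) //= unlift_none /= normr1 gtr_pMr //.
by rewrite ltNge lerDl sumr_ge0 //.
Qed.

Lemma lin_indep_coord (R : realType) (V : lmodType R) n (b : 'I_n -> V) :
  lin_indep b -> exists co : V -> 'I_n -> R, forall c, co (lincomb b c) = c.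
Proof.
move=> fb.
have /choice[co coP] : forall v, exists c, range (lincomb b) v -> lincomb b c = v.
  move=> v; have [[c _ cv]|nv] := pselect (range (lincomb b) v).
    by exists c.
  by exists (fun=> 0).
exists co => c; apply: (lin_indep_inj fb); apply: coP; by exists c.
Qed.

Lemma linear_on_lincomb (R : realType) (V W : lmodType R) (E : set V)
    (T : V -> W) n (b : 'I_n -> V) (c : 'I_n -> R) :
  linear_on E T -> (forall d, E (lincomb b d)) ->
  T (lincomb b c) = lincomb (fun i => T (b i)) c.
Proof.
move=> Tl Eb.
have E0 : E 0 by rewrite -(lincomb0 b).
have T0 : T 0 = 0.
  by have := Tl (-1) 0 0 E0 E0; rewrite scaler0 addr0 scaleN1r addNr.
(* Partial sums of the combination are combinations, so they stay in E. *)
have partial (s : seq 'I_n) : exists d, \sum_(i <- s) c i *: b i = lincomb b d.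
  elim: s => [|i s [d dE]]; first by exists (fun=> 0); rewrite big_nil lincomb0.
  exists (fun j => c i * (j == i)%:R + d j).
  by rewrite big_cons dE lincombP lincomb_unit.
rewrite [in LHS]/lincomb [in RHS]/lincomb.
elim: (index_enum _) => [|i s IH]; rewrite ?big_nil // !big_cons Tl ?IH //.
  by rewrite -lincomb_unit.
by have [d ->] := partial s.
Qed.

Lemma bounded_dual (R : realType) (V : normedModType R) (f : V -> R) (M : R) :
  linear f -> (forall x, `|f x| <= M * `|x|) -> f \in dual_pred V.
Proof.
move=> lf fM; rewrite inE; split => //.
pose F : {linear V -> R} := HB.pack f (GRing.isLinear.Build _ _ _ _ _ lf).
apply: (@bounded_linear_continuous _ _ _ F).
apply/bounded_funP => r; exists (`|M| * r) => x xr.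
rewrite (le_trans (fM x)) // (le_trans (ler_wpM2r _ (ler_norm M))) //.
by rewrite ler_wpM2l.
Qed.

Lemma dual_lincomb (R : realType) (V : normedModType R) (f : dual V) n
    (b : 'I_n -> V) c : f (lincomb b c) = \sum_(i < n) c i * f (b i).
Proof.
by rewrite (@linear_on_lincomb _ _ _ setT) // => a x y _ _; exact: dual_linear.
Qed.

Lemma lincomb_norm_le (R : realType) (V : normedModType R) n
    (b : 'I_n -> V) c : `|lincomb b c| <= \sum_(i < n) `|c i| * `|b i|.
Proof.
apply: le_trans (ler_norm_sum _ _ _) _; apply: ler_sum => i _.
by rewrite normrZ.
Qed.

(** An element phi of the bidual is evaluation at the vector whose coordinates
    are the values of phi at the coordinate functionals. *)
Lemma finite_dimensional_reflexive (R : realType)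
    (X : completeNormedModType R) :
  finite_dimensional [set: X] -> reflexive_space X.
Proof.
move=> /finite_dimensional_basis[n [b [fb bT]]] phi.
have [k k0 kb] := lin_indep_lower_bound fb.
have [co coE] := lin_indep_coord fb.
have bco v : lincomb b (co v) = v.
  have : [set: X] v by [].
  by rewrite bT => -[c _ <-]; rewrite coE.
have coord_dual i : (fun v => co v i) \in dual_pred X.
  apply: (@bounded_dual _ _ _ k^-1) => [a x y|x].
    by rewrite -{1}(bco x) -{1}(bco y) -lincombP coE.
  rewrite ler_pdivlMl // -{2}(bco x); apply: le_trans (kb _).
  by rewrite ler_pM2l // (bigD1 i) //= lerDl sumr_ge0.
pose f i := Dual (coord_dual i).
exists (lincomb b (fun i => phi (f i))).
apply/val_inj/funext => g /=; rewrite dual_lincomb.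
have -> : g = lincomb f (fun i => g (b i)).
  apply/val_inj/funext => x /=.
  rewrite -[in LHS](bco x) dual_lincomb.
  have := dual_lincomb (bidual_embedding x) f (fun i => g (b i)).
  rewrite /= => ->; apply: eq_bigr => i _; exact: mulrC.
rewrite dual_lincomb; apply: eq_bigr => i _; rewrite mulrC; congr (_ * _).
rewrite -[LHS]/(bidual_embedding (b i) (lincomb f (fun j => g (b j)))).
rewrite dual_lincomb (bigD1 i) //= big1 => [|j ji].
  by rewrite -[in co _](lincomb_unit b) coE eqxx mulr1 addr0.
by rewrite -[in co _](lincomb_unit b) coE (negPf ji) mulr0.
Qed.

(** * Finite representability *)

Lemma opnorm_le (R : realType) (V W : normedModType R) (E : set V)
    (T : V -> W) (M : R) : E 0 -> 0 <= M ->
  (forall x, E x -> `|T x| <= M * `|x|) -> 0 <= opnorm E T <= M.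
Proof.
move=> E0 M0 TM.
have ub : forall y, [set `|T x| | x in [set x | E x /\ `|x| <= 1]] y -> y <= M.
  move=> _ [x [Ex x1] <-]; apply: le_trans (TM _ Ex) _.
  by rewrite ler_piMr.
have in0 : [set `|T x| | x in [set x | E x /\ `|x| <= 1]] `|T 0|.
  by exists 0 => //=; split=> //; rewrite normr0.
apply/andP; split; last by apply: ge_sup => //; exists `|T 0|.
by apply: le_trans (normr_ge0 (T 0)) _; apply: ub_le_sup => //; exists M.
Qed.

(** Measuring the error by the l^1 norm of the coefficients makes sense for
    dependent families too; for a basis it becomes a relative error, by
    [lin_indep_lower_bound]. *)
Definition has_almost_isometric_copies (R : realType)
    (Y X : normedModType R) :=
  forall d (b : 'I_d -> Y) (eta : R), 0 < eta -> exists b' : 'I_d -> X,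
    forall c, `| `|lincomb b' c| - `|lincomb b c| | <=
              eta * \sum_(i < d) `|c i|.

(** Perturbation: on a finite-dimensional subspace the l^1 norm of the
    coordinates is controlled by the norm, so an approximate copy of a basis
    spans an almost isometric copy of the subspace. *)
Lemma almost_isometric_copies_finitely_representable (R : realType)
    (Y X : completeNormedModType R) :
  has_almost_isometric_copies Y X -> finitely_representable Y X.
Proof.
move=> copies E eps /finite_dimensional_basis[d [b [fb ->]]] eps0.
have [k k0 kb] := lin_indep_lower_bound fb.
(* Any h < 1 with (1 + h) / (1 - h) < 1 + eps would do. *)
pose h := eps / (3 + eps).
have e3 : 0 < 3 + eps by rewrite addr_gt0.
have h0 : 0 < h by rewrite divr_gt0.
have h1 : 0 < 1 - h by rewrite subr_gt0 ltr_pdivrMr // mul1r ltrDr.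
have [b' b'E] := copies d b (k * h) (mulr_gt0 k0 h0).
have b'h c : `| `|lincomb b' c| - `|lincomb b c| | <= h * `|lincomb b c|.
  apply: le_trans (b'E c) _; rewrite mulrAC mulrC ler_wpM2l ?kb //.
  exact: ltW.
have lo c : (1 - h) * `|lincomb b c| <= `|lincomb b' c|.
  by have := b'h c; rewrite ler_norml => /andP[+ _]; rewrite mulrBl mul1r; lra.
have up c : `|lincomb b' c| <= (1 + h) * `|lincomb b c|.
  by have := b'h c; rewrite ler_norml => /andP[_ +]; rewrite mulrDl mul1r; lra.
have fb' : lin_indep b'.
  move=> c b'c0; apply: fb; apply/normr0_eq0/eqP.
  rewrite eq_le normr_ge0 andbT -(pmulr_rle0 _ h1).
  by apply: le_trans (lo c) _; rewrite b'c0 normr0.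
have [co coE] := lin_indep_coord fb.
have [co' co'E] := lin_indep_coord fb'.
exists (range (lincomb b')), (lincomb b' \o co), (lincomb b \o co'); split.
- exact: finite_dimensional_range.
- by move=> a _ _ [c _ <-] [c' _ <-]; rewrite /= -lincombP !coE -lincombP.
- split.
  + by move=> _ [c _ <-]; exists c => //=; rewrite coE.
  + move=> _ _ /set_mem[c _ <-] /set_mem[c' _ <-] /=; rewrite !coE.
    by move=> /(lin_indep_inj fb') ->.
  + by move=> _ [c _ <-]; exists (lincomb b c); [exists c|rewrite /= coE].
- by move=> _ [c _ <-] /=; rewrite coE co'E.
have range0 (V : lmodType R) (a : 'I_d -> V) : range (lincomb a) 0.
  by exists (fun=> 0); rewrite ?lincomb0.
have /andP[n0 n1] : 0 <= opnorm (range (lincomb b)) (lincomb b' \o co) <= 1 + h.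
  apply: opnorm_le => //; first by rewrite addr_ge0 // ltW.
  by move=> _ [c _ <-] /=; rewrite coE.
have /andP[n'0 n'1] :
    0 <= opnorm (range (lincomb b')) (lincomb b \o co') <= (1 - h)^-1.
  apply: opnorm_le => //; first by rewrite invr_ge0 ltW.
  by move=> _ [c _ <-] /=; rewrite co'E ler_pdivlMl.
apply: le_lt_trans (ler_pM n0 n'0 n1 n'1) _.
rewrite ltr_pdivrMr //.
have he : h * (3 + eps) = eps by rewrite divfK // gt_eqF.
by nra.
Qed.

(** The isomorphisms map independent families of Y to independent families
    of X. *)
Lemma finitely_representable_finite_dimensional (R : realType)
    (Y X : completeNormedModType R) : finitely_representable Y X ->
  finite_dimensional [set: X] -> finite_dimensional [set: Y].
Proof.
move=> YX /finite_dimensional_basis[N [x [_ xT]]].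
apply: (@bounded_lin_indep_finite_dimensional _ _ N) => n b fb.
have [G [T [T' [_ Tl _ T'T _]]]] :=
  YX _ 1 (finite_dimensional_range b) ltr01.
apply: (@lin_indep_card _ _ _ _ (fun i => T (b i)) x); last by move=> i; rewrite -xT.
have Eb c : range (lincomb b) (lincomb b c) by exists c.
move=> c; rewrite -(linear_on_lincomb _ Tl Eb) => Tc0; apply: fb.
rewrite -(T'T _ (Eb c)) Tc0 -[RHS](T'T _ (_ : range (lincomb b) 0)).
  congr T'; rewrite -(lincomb0 b) (linear_on_lincomb _ Tl Eb).
  by rewrite lincomb0.
by rewrite -(lincomb0 b).
Qed.

(** * Uniformly convex norms *)

Section euclidean_norm.
Context (R : realType) (n : nat).
Implicit Types c d : 'I_n -> R.

Definition l2norm c : R := Num.sqrt (\sum_(i < n) c i ^+ 2).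

Lemma l2norm_ge0 c : 0 <= l2norm c. Proof. exact: sqrtr_ge0. Qed.

Lemma l2norm_sqr c : l2norm c ^+ 2 = \sum_(i < n) c i ^+ 2.
Proof. by rewrite sqr_sqrtr // sumr_ge0 // => i _; exact: sqr_ge0. Qed.

Lemma l2norm_coord c i : `|c i| <= l2norm c.
Proof.
rewrite -ler_sqr ?nnegrE ?l2norm_ge0 // l2norm_sqr real_normK ?num_real //.
by rewrite (bigD1 i) //= lerDl sumr_ge0 // => j _; exact: sqr_ge0.
Qed.

Lemma l2norm_le_l1 c : l2norm c <= \sum_(i < n) `|c i|.
Proof.
have s0 : 0 <= \sum_(i < n) `|c i| by exact: sumr_ge0.
rewrite -ler_sqr ?nnegrE ?l2norm_ge0 // l2norm_sqr expr2 mulr_suml.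
apply: ler_sum => i _; rewrite -real_normK ?num_real // expr2 ler_wpM2l //.
by rewrite (bigD1 i) //= lerDl sumr_ge0.
Qed.

Lemma l2normZ a c : l2norm (fun i => a * c i) = `|a| * l2norm c.
Proof.
rewrite /l2norm; under eq_bigr do rewrite exprMn.
by rewrite -mulr_sumr sqrtrM ?sqr_ge0 // sqrtr_sqr.
Qed.

(** Minkowski's inequality, from the convexity bound
    (x + y)^2 <= (s + t) (x^2 / s + y^2 / t) with s, t the two norms. *)
Lemma l2normD c d : l2norm (fun i => c i + d i) <= l2norm c + l2norm d.
Proof.
have eq0 (a : 'I_n -> R) i : l2norm a = 0 -> a i = 0.
  by move=> a0; apply/eqP; rewrite -normr_le0 -a0 l2norm_coord.
have [c0|cn0] := eqVneq (l2norm c) 0.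
  rewrite c0 add0r (_ : (fun i => c i + d i) = d) //.
  by apply/funext => i; rewrite (eq0 c) // add0r.
have [d0|dn0] := eqVneq (l2norm d) 0.
  rewrite d0 addr0 (_ : (fun i => c i + d i) = c) //.
  by apply/funext => i; rewrite (eq0 d) // addr0.
set s := l2norm c in cn0 *; set t := l2norm d in dn0 *.
have s0 : 0 < s by rewrite lt_def cn0 l2norm_ge0.
have t0 : 0 < t by rewrite lt_def dn0 l2norm_ge0.
rewrite -ler_sqr ?nnegrE ?addr_ge0 ?l2norm_ge0 // l2norm_sqr.
have -> : (s + t) ^+ 2 =
    \sum_(i < n) (s + t) * (c i ^+ 2 / s + d i ^+ 2 / t).
  rewrite -mulr_sumr big_split /= -!mulr_suml -!l2norm_sqr -/s -/t.
  by field; rewrite cn0 dn0.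
apply: ler_sum => i _; rewrite -subr_ge0.
have -> : (s + t) * (c i ^+ 2 / s + d i ^+ 2 / t) - (c i + d i) ^+ 2 =
    (t * c i - s * d i) ^+ 2 / (s * t).
  by field; rewrite cn0 dn0.
by rewrite divr_ge0 ?sqr_ge0 // mulr_ge0 // ltW.
Qed.

Lemma l2norm_parallelogram c d :
  l2norm (fun i => 2^-1 * (c i + d i)) ^+ 2 =
  (l2norm c ^+ 2 + l2norm d ^+ 2) / 2 - l2norm (fun i => c i - d i) ^+ 2 / 4.
Proof.
rewrite !l2norm_sqr -big_split /= !mulr_suml -sumrB.
by apply: eq_bigr => i _; field.
Qed.

End euclidean_norm.

(** The Euclidean norm of the coordinates in a basis is uniformly convex by the
    parallelogram identity. *)
Lemma finite_dimensional_uniformly_convex (R : realType)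
    (X : normedModType R) : finite_dimensional [set: X] ->
  exists N : X -> R, equivalent_norm N /\ uniformly_convex N.
Proof.
move=> /finite_dimensional_basis[n [b [fb bT]]].
have [k k0 kb] := lin_indep_lower_bound fb.
have [co coE] := lin_indep_coord fb.
have bco v : lincomb b (co v) = v.
  have : [set: X] v by [].
  by rewrite bT => -[c _ <-]; rewrite coE.
have coZ a x : co (a *: x) = fun i => a * co x i.
  by rewrite -{1}(bco x) -lincombZ coE.
have coD x y : co (x + y) = fun i => co x i + co y i.
  rewrite -{1}(bco x) -{1}(bco y) -[lincomb b (co x)]scale1r -lincombP coE.
  by apply/funext => i; rewrite mul1r.
have coB x y : co (x - y) = fun i => co x i - co y i.
  by rewrite -scaleN1r coD coZ; apply/funext => i; rewrite mulN1r.
exists (fun x => l2norm (co x)); split; first split.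
- split=> [x y|a x|x x0].
  + by rewrite coD l2normD.
  + by rewrite coZ l2normZ.
  + rewrite -(bco x) -[RHS](lincomb0 b); apply: eq_lincomb => i.
    by apply/eqP; rewrite -normr_le0 -x0 l2norm_coord.
- set B := \sum_(i < n) `|b i|.
  have B0 : 0 <= B by exact: sumr_ge0.
  have B1 : 0 < 1 + B by rewrite ltr_wpDr.
  exists (1 + B)^-1, k^-1; split; rewrite ?invr_gt0 // => x.
  apply/andP; split.
    rewrite ler_pdivrMl // -{1}(bco x).
    apply: le_trans (lincomb_norm_le _ _) _.
    apply: (@le_trans _ _ (B * l2norm (co x))).
      rewrite /B mulr_suml; apply: ler_sum => i _.
      by rewrite mulrC ler_wpM2l // l2norm_coord.
    by rewrite ler_wpM2r ?l2norm_ge0 // lerDr.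
  apply: le_trans (l2norm_le_l1 _) _.
  by rewrite ler_pdivlMl // -{2}(bco x).
move=> eps eps0; exists (eps ^+ 2 / 8); first by rewrite divr_gt0 // exprn_gt0.
move=> x y x1 y1 exy.
have exy2 : eps ^+ 2 <= l2norm (co (x - y)) ^+ 2.
  by rewrite ler_sqr ?nnegrE ?l2norm_ge0 // ltW.
have := l2norm_parallelogram (co x) (co y).
rewrite x1 y1 coZ coD -coB expr1n => par.
have m0 := sqr_ge0 (l2norm (fun i => 2^-1 * (co x i + co y i))).
rewrite -ler_sqr ?nnegrE ?l2norm_ge0 //; last by lra.
have : 0 <= (eps ^+ 2 / 8) ^+ 2 by exact: sqr_ge0.
rewrite sqrrB expr1n; lra.
Qed.

Section uniformly_convex_trees.
Context (R : realType) (V : lmodType R) (N : V -> R).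
Hypothesis N_norm : is_norm N.
Hypothesis N_uc : uniformly_convex N.

Let ND x y : N (x + y) <= N x + N y. Proof. by case: N_norm. Qed.
Let NZ a x : N (a *: x) = `|a| * N x. Proof. by case: N_norm. Qed.
Let N0 : N 0 = 0. Proof. by rewrite -(scale0r 0) NZ normr0 mul0r. Qed.
Let NN x : N (- x) = N x. Proof. by rewrite -scaleN1r NZ normrN1 mul1r. Qed.

(** If neither vector is much shorter than 1, normalising them moves them
    by little, and the definition applies; otherwise the triangle
    inequality suffices. *)
Lemma uniformly_convex_ball eps : 0 < eps -> exists2 delta, 0 < delta < 1 &
  forall x y, N x <= 1 -> N y <= 1 -> eps <= N (x - y) ->
    N (2^-1 *: (x + y)) <= 1 - delta.
Proof.
move=> eps0.
have [d d0 dP] := N_uc (divr_gt0 eps0 (ltr0n _ 2)).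
pose h := Num.min 2^-1 (Num.min (eps / 4) (d / 2)).
have h0 : 0 < h by rewrite !lt_min invr_gt0 ltr0n !divr_gt0.
have h2 : h <= 2^-1 by rewrite ge_min lexx.
have h4 : h <= eps / 4 by rewrite !ge_min lexx orbT.
have hd : h <= d / 2 by rewrite !ge_min lexx !orbT.
exists (h / 2); first by lra.
move=> x y x1 y1 exy.
have mid u v : N (2^-1 *: (u + v)) <= 2^-1 * (N u + N v).
  by rewrite NZ ger0_norm ?invr_ge0 // ler_wpM2l ?invr_ge0.
have [xh|xh] := lerP (N x) (1 - h).
  by apply: le_trans (mid _ _) _; lra.
have [yh|yh] := lerP (N y) (1 - h).
  by apply: le_trans (mid _ _) _; lra.
have unit_vec z : 1 - h < N z -> N z <= 1 ->
    N ((N z)^-1 *: z) = 1 /\ N (z - (N z)^-1 *: z) <= h.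
  move=> zh z1.
  have z0 : 0 < N z by lra.
  rewrite NZ gtr0_norm ?invr_gt0 // mulVf ?gt_eqF //; split=> //.
  have -> : z - (N z)^-1 *: z = (1 - (N z)^-1) *: z by rewrite scalerBl scale1r.
  rewrite NZ ler0_norm ?subr_le0 ?invf_ge1 //.
  by rewrite opprB mulrBl mul1r mulVf ?gt_eqF //; lra.
have [x'1 xx'] := unit_vec x xh x1.
have [y'1 yy'] := unit_vec y yh y1.
set x' := _ *: x in x'1 xx'; set y' := _ *: y in y'1 yy'.
have exy' : eps / 2 <= N (x' - y').
  have : N (x - y) <= N (x - x') + (N (x' - y') + N (y - y')).
    rewrite -(NN (y - y')) opprB.
    have -> : x - y = (x - x') + ((x' - y') + (y' - y)) by rewrite !addrA !subrK.
    by apply: le_trans (ND _ _) _; rewrite lerD2l.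
  by lra.
have := dP _ _ x'1 y'1 exy'.
have -> : 2^-1 *: (x + y) = 2^-1 *: (x' + y') + 2^-1 *: ((x - x') + (y - y')).
  rewrite -scalerDr; congr (_ *: _).
  by rewrite addrACA (addrC x') subrK (addrC y') subrK.
move=> mid'; apply: le_trans (ND _ _) _.
have := mid (x - x') (y - y').
by lra.
Qed.

(** The means over consecutive blocks of length 2^j are the nodes at height j
    of a dyadic tree, with leaves the terms of the sequence. *)
Definition block_mean j (x : nat -> V) i : V :=
  2^-1 ^+ j *: \sum_(i <= l < i + 2 ^ j) x l.

Lemma block_meanS j x i :
  block_mean j.+1 x i = 2^-1 *: (block_mean j x i + block_mean j x (i + 2 ^ j)).
Proof.
rewrite /block_mean -scalerDr scalerA -exprS; congr (_ *: _).
by rewrite expnS mul2n -addnn addnA (@big_cat_nat _ _ _ (i + 2 ^ j)) ?leq_addr.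
Qed.

(** Each averaging of separated siblings gains a factor 1 - delta, so the
    nodes near the root of a tall tree are too short to be separated. *)
Lemma uniformly_convex_no_tree (M theta : R) : 0 < theta ->
  exists n, forall x : nat -> V, (forall l, (l < 2 ^ n)%N -> N (x l) <= M) ->
  ~ (forall j i, (i + 2 ^ j.+1 <= 2 ^ n)%N ->
       theta <= N (block_mean j x i - block_mean j x (i + 2 ^ j))).
Proof.
move=> theta0; pose r0 := `|M| + 1.
have r00 : 0 < r0 by rewrite ltr_wpDl.
have [d /andP[d0 d1] dP] := uniformly_convex_ball (divr_gt0 theta0 r00).
have q0 : 0 < 1 - d by lra.
have q1 : `|1 - d| < 1 by rewrite ger0_norm; lra.
have [n nq] : exists n, r0 * (1 - d) ^+ n < theta / 2.
  have /cvgrPdist_lt/(_ _ (divr_gt0 (divr_gt0 theta0 (ltr0n _ 2)) r00)) :=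
    cvg_expr q1.
  move=> [n _ /(_ n)] /=; rewrite leqnn => /(_ isT) H; exists n.
  rewrite mulrC -ltr_pdivlMr //; apply: le_lt_trans H.
  by rewrite sub0r normrN ler_norm.
exists n.+1 => x xM sep.
have shrink r u v : 0 < r -> r <= r0 -> N u <= r -> N v <= r ->
    theta <= N (u - v) -> N (2^-1 *: (u + v)) <= r * (1 - d).
  move=> rgt0 rr0 ur vr uv.
  have rN w : N (r^-1 *: w) = r^-1 * N w by rewrite NZ gtr0_norm ?invr_gt0.
  have := dP (r^-1 *: u) (r^-1 *: v).
  rewrite -scalerBr -scalerDr scalerA [2^-1 * _]mulrC -scalerA !rN.
  rewrite !ler_pdivrMl // mulr1 => /(_ ur vr); apply.
  rewrite ler_pdivlMl //; apply: le_trans uv.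
  by rewrite mulrCA ler_piMr ?(ltW theta0) // ler_pdivrMr // mul1r.
have bound j i : (i + 2 ^ j <= 2 ^ n.+1)%N ->
    N (block_mean j x i) <= r0 * (1 - d) ^+ j.
  elim: j i => [|j IH] i ij.
    rewrite /block_mean expr0 scale1r expn0 addn1 big_nat1 mulr1.
    rewrite addn1 in ij.
    by have := xM _ ij; have := ler_norm M; rewrite /r0; lra.
  rewrite block_meanS.
  have rgt0 : 0 < r0 * (1 - d) ^+ j by rewrite mulr_gt0 // exprn_gt0.
  have rr0 : r0 * (1 - d) ^+ j <= r0.
    by rewrite ler_piMr ?(ltW r00) // exprn_ile1 ?(ltW q0) // gerBl ltW.
  have ij1 : (i + 2 ^ j <= 2 ^ n.+1)%N.
    by apply: leq_trans ij; rewrite leq_add2l leq_exp2l.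
  have ij2 : (i + 2 ^ j + 2 ^ j <= 2 ^ n.+1)%N.
    by rewrite -addnA addnn -mul2n -expnS.
  by rewrite exprSr mulrA; apply: shrink; rewrite ?IH ?sep.
have n2 : (0 + 2 ^ n.+1 <= 2 ^ n.+1)%N by [].
have b1 : N (block_mean n x 0) <= r0 * (1 - d) ^+ n.
  by apply: bound; rewrite add0n leq_exp2l.
have b2 : N (block_mean n x (0 + 2 ^ n)) <= r0 * (1 - d) ^+ n.
  by apply: bound; rewrite add0n addnn -mul2n -expnS.
have := sep n 0%N n2.
have := ND (block_mean n x 0) (- block_mean n x (0 + 2 ^ n)).
by rewrite NN; lra.
Qed.

End uniformly_convex_trees.

(** * Patterns *)

Section patterns.
Context (Omega : Type) (V : finType) (f : nat -> Omega -> V).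
Context (U : set_system nat) {UU : UltraFilter U}.
Implicit Types (s t : seq V) (Q : set Omega).

Lemma ultra_exists (I : finType) (B : I -> set nat) :
  U [set i | exists j, B j i] -> exists j, U (B j).
Proof.
move=> UB; apply: contrapT => nB.
have : U [set i | forall j, ~ B j i].
  apply: filter_forall => j.
  have [Uj|//] := in_ultra_setVsetC (B j) UU.
  by exfalso; apply: nB; exists j.
move=> UnB; have [i [[j Bji] /(_ j)]] := filter_ex (filterI UB UnB).
exact.
Qed.

Lemma ultra_iff (P : Prop) (B : set nat) : (P <-> U B) ->
  U [set i | P <-> B i].
Proof.
move=> PB; have [UB|UnB] := in_ultra_setVsetC B UU.
  have HP : P by apply/PB.
  by apply: filterS UB => i Bi; split.
apply: (filterS _ UnB) => i nBi; split=> [/PB UB|/nBi[]].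
by have [? []] := filter_ex (filterI UB UnB).
Qed.

(** Says that U-almost every i_1, then U-almost every i_2, and so on, admit a
    point w of Q at which f i_1, f i_2, ... take the values listed in s. The set
    Q is a parameter because fixing the first value amounts to shrinking it. *)
Fixpoint pattern s Q : Prop :=
  if s is v :: s' then U [set i | pattern s' (Q `&` [set w | f i w = v])]
  else Q !=set0.

Lemma patternS s Q Q' : Q `<=` Q' -> pattern s Q -> pattern s Q'.
Proof.
elim: s Q Q' => [|v s IH] Q Q' QQ' /=; first exact: subset_nonempty.
apply: filterS => i; apply: IH; exact: setSI.
Qed.

Lemma pattern_nonempty s Q : pattern s Q -> Q !=set0.
Proof.
elim: s Q => [//|v s IH] Q /= /filter_ex[i /IH].
by apply: subset_nonempty => w [].
Qed.

Lemma pattern_subseq s t Q : subseq s t -> pattern t Q -> pattern s Q.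
Proof.
elim: t s Q => [|v t IH] [|u s] Q //=.
  by move=> _; apply: (@pattern_nonempty (v :: t)).
case: eqP => [->|_] st Ut; first by apply: filterS Ut => i; exact: IH.
have [i] := filter_ex Ut; move=> /(IH _ _ st).
by apply: (@patternS (u :: s)) => w [].
Qed.

(** Ultrafilter quantifiers commute with finite disjunctions; by induction on
    the length of the pattern, so do patterns. *)
Lemma pattern_partition s Q (B : V -> set Omega) :
  (forall w, Q w -> exists v, B v w) -> pattern s Q ->
  exists v, pattern s (Q `&` B v).
Proof.
elim: s Q => [|u s IH] Q QB /=.
  by move=> [w Qw]; have [v Bvw] := QB _ Qw; exists v, w.
move=> Us; apply: ultra_exists; apply: filterS Us => i /=.
move=> /IH[w [Qw _]|v]; first exact: QB.
move=> sv; exists v; apply: patternS sv => w [[Qw fw] Bw].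
by split.
Qed.

Lemma pattern_insert s t Q : pattern (s ++ t) Q ->
  exists v, pattern (s ++ v :: t) Q.
Proof.
elim: s Q => [|u s IH] Q /= st.
  apply: ultra_exists; apply: filterE => i /=.
  by apply: pattern_partition st => w _; exists (f i w).
apply: ultra_exists; apply: filterS st => i; exact: IH.
Qed.

(** The indices are chosen one after the other, so as to decide correctly
    the finitely many words of length n. Fixing the value of the first function
    splits each set Q into finitely many, hence the induction on families of
    sets. *)
Lemma pattern_realized n (J : finType) (Q : J -> set Omega) :
  exists x : seq nat, size x = n /\ forall j (s : n.-tuple V),
    pattern s (Q j) <-> exists w, Q j w /\ [seq f i w | i <- x] = s.
Proof.
elim: n J Q => [|n IH] J Q.
  exists [::]; split=> // j s; rewrite tuple0 /=.
  by split=> [[w Qw]|[w [Qw _]]]; exists w.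
have : U [set i | forall z : J * V * n.-tuple V, pattern (z.1.2 :: z.2) (Q z.1.1) <->
    pattern z.2 (Q z.1.1 `&` [set w | f i w = z.1.2])].
  by apply: filter_forall => z; exact: ultra_iff.
move=> /filter_ex[i iP].
have [x [sx xP]] := IH _ (fun z : J * V => Q z.1 `&` [set w | f i w = z.2]).
exists (i :: x); split; first by rewrite /= sx.
move=> j s; case/tupleP: s => v s.
apply: (iff_trans (iP (j, v, s))); apply: (iff_trans (xP (j, v) s)).
split=> [[w [[Qw /= <-] ws]]|[w [Qw [fw ws]]]].
  by exists w; split=> //=; rewrite ws.
by exists w; split=> //; apply: val_inj.
Qed.

Definition is_pattern s := pattern s setT.

Definition pattern_point : Type :=
  {p : nat -> V | forall n, is_pattern (mkseq p n)}.

(** Letters are appended one by one. *)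
Lemma pattern_point_extend s : is_pattern s ->
  exists p : pattern_point, mkseq (sval p) (size s) = s.
Proof.
move=> ps.
have /choice[g gP] : forall s, exists v,
    is_pattern s -> is_pattern (rcons s v).
  move=> s'; have [ps'|np] := pselect (is_pattern s').
    have [|v] := @pattern_insert s' [::] setT; first by rewrite cats0.
    by rewrite cats1; exists v.
  have [v _] := @pattern_insert [::] [::] setT (pattern_nonempty ps).
  by exists v.
pose step s := rcons s (g s).
pose S n := iter n step s.
have sizeS n : size (S n) = (size s + n)%N.
  by elim: n => [|n IH]; rewrite ?addn0 //= size_rcons IH addnS.
have SP n : is_pattern (S n) by elim: n => [//|n IH]; exact: gP.
have [v0 _] := @pattern_insert [::] [::] setT (pattern_nonempty ps).
pose p i := nth v0 (S i.+1) i.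
have nthS m n i : (i < size s + m)%N -> nth v0 (S (m + n)%N) i = nth v0 (S m) i.
  move=> im; elim: n => [|n IH]; first by rewrite addn0.
  rewrite addnS [S _]/= nth_rcons sizeS.
  by rewrite (leq_trans im) // leq_add2l leq_addr.
have pS n i : (i < size s + n)%N -> p i = nth v0 (S n) i.
  move=> im; rewrite /p -(nthS i.+1 n) -1?(nthS n i.+1) //.
    by rewrite addnC.
  by rewrite ltn_addl.
have mkS n : mkseq p (size s + n)%N = S n.
  apply: (@eq_from_nth _ v0); first by rewrite size_mkseq sizeS.
  by move=> i; rewrite size_mkseq => im; rewrite nth_mkseq // (pS n).
suff pP : forall n, is_pattern (mkseq p n).
  by exists (exist _ p pP); rewrite /= -[size s]addn0 mkS.
move=> n; apply: (@pattern_subseq _ (mkseq p (size s + n)%N)).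
  rewrite /mkseq addnC iotaD map_cat; exact: prefix_subseq.
rewrite mkS; exact: SP.
Qed.

End patterns.

(** * Steps and spikes *)

Lemma nseq_subseq (T : eqType) (u : T) (s : seq T) m :
  (m <= count_mem u s)%N -> subseq (nseq m u) s.
Proof.
elim: s m => [|v s IH] [|m] //=.
have [_|_] := eqVneq v u; first exact: IH.
by rewrite add0n => /IH.
Qed.

Lemma subseq_nseq (T : eqType) (u : T) m n :
  (m <= n)%N -> subseq (nseq m u) (nseq n u).
Proof. by move=> mn; apply: nseq_subseq; rewrite count_nseq /= eqxx mul1n. Qed.

Lemma seq_pigeonhole (V : finType) (v0 : V) (s : seq V) m :
  (m * #|V| <= size s)%N -> exists u, subseq (nseq m u) s.
Proof.
move=> ms; have [/existsP[u mu]|] := boolP [exists u, (m <= count_mem u s)%N].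
  by exists u; exact: nseq_subseq.
rewrite negb_exists => /forallP few; exfalso; move: ms; apply/negP.
rewrite -ltnNge -sum1_size.
rewrite (partition_big (fun v : V => v) xpredT) //=.
rewrite mulnC -sum_nat_const (bigD1 v0) //= [X in (_ < X)%N](bigD1 v0) //=.
rewrite -addSn leq_add //.
  by have := few v0; rewrite -ltnNge -sum1_count.
by apply: leq_sum => v _; rewrite sum1_count; apply: ltnW; rewrite ltnNge; exact: few.
Qed.

Lemma count_recurrent (T : eqType) (p : nat -> T) u :
  (forall n, exists2 i, (n <= i)%N & p i = u) ->
  forall k n, exists m, (k <= count_mem u (mkseq (fun i => p (n + i)%N) m))%N.
Proof.
move=> rec; elim=> [|k IH] n; first by exists 0%N.
have [i ni pi] := rec n; have [m km] := IH i.+1.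
exists ((i - n).+1 + m)%N.
rewrite /mkseq iotaD map_cat count_cat -addn1 addnC leq_add //.
  rewrite -has_count has_map; apply/hasP; exists (i - n)%N.
    by rewrite mem_iota /= add0n ltnS.
  by rewrite /= subnKC // pi.
apply: leq_trans km _; rewrite add0n /mkseq.
rewrite -(addn0 (i - n).+1) iotaDl -map_comp.
rewrite (@eq_map _ _ _ (fun j => p (i.+1 + j)%N)) // => j /=.
by rewrite addnA addnS subnKC.
Qed.

Section dichotomy.
Context (Omega : Type) (V : finType) (f : nat -> Omega -> V).
Context (U : set_system nat) {UU : UltraFilter U} (Uoo : \oo `<=` U).
Hypothesis f_distinct : forall i j, i != j -> exists w, f i w != f j w.
Local Notation pat s := (is_pattern f U s).

Let U_ge n : U [set i | (n <= i)%N].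
Proof. by apply: Uoo; exists n. Qed.

(** A choice that works for arbitrarily large n works for all n. *)
Lemma ultra_antitone (I : finType) (B : nat -> I -> Prop) :
  (forall m n j, (m <= n)%N -> B n j -> B m j) ->
  (forall n, exists j, B n j) -> exists j, forall n, B n j.
Proof.
move=> Bmn Bn; have [|j Uj] := @ultra_exists U UU I (fun j => [set n | B n j]).
  exact: filterE.
exists j => n; have [m [Bmj nm]] := filter_ex (filterI Uj (U_ge n)).
exact: Bmn nm Bmj.
Qed.

(** For all j > i some pair of distinct letters occurs as a pair of values of
    f i and f j; the ultrafilter selects one such pair for most i and j. *)
Lemma pattern_jump : exists a b, a != b /\ pat [:: a; b].
Proof.
have [|z Uz] := @ultra_exists U UU (V * V)%type (fun z => [set i | U [set j |
    z.1 != z.2 /\ exists w, f i w = z.1 /\ f j w = z.2]]).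
  apply: filterE => i /=; apply: ultra_exists.
  apply: filterS (U_ge i.+1) => j ij.
  have [|w fw] := @f_distinct i j; first by rewrite neq_ltn (ij : (i < j)%N).
  by exists (f i w, f j w); split=> //; exists w.
exists z.1, z.2; split.
  have [i Ui] := filter_ex Uz.
  by have [j []] := filter_ex Ui.
rewrite /is_pattern /=; apply: filterS Uz => i; apply: filterS => j.
by move=> [_ [w [fi fj]]]; exists w.
Qed.

Lemma pattern_pad s m : pat s ->
  exists l r, [/\ size l = m, size r = m & pat (l ++ s ++ r)].
Proof.
move=> ps; elim: m => [|m [l [r [lm rm plr]]]].
  by exists [::], [::]; rewrite cats0.
have [u] := @pattern_insert _ _ _ _ _ [::] (l ++ s ++ r) setT plr.
move=> pu.
have [|v] := @pattern_insert Omega V f U UU (u :: l ++ s ++ r) [::] setT.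
  by rewrite cats0.
move=> puv; exists (u :: l), (rcons r v); rewrite /= size_rcons lm rm.
by split=> //; rewrite -cats1 catA -catA; move: puv; rewrite /= !catA.
Qed.

Lemma is_pattern_subseq s t : subseq s t -> pat t -> pat s.
Proof. exact: pattern_subseq. Qed.

(** Many letters are inserted around a pattern ab, and the pigeonhole principle
    keeps equal ones on each side. *)
Lemma pattern_core : exists u v a b, a != b /\
  forall m, pat (nseq m u ++ [:: a; b] ++ nseq m v).
Proof.
have [a [b [ab pab]]] := pattern_jump.
have [||[u v] uvP] := @ultra_antitone (V * V)%type
  (fun m z => pat (nseq m z.1 ++ [:: a; b] ++ nseq m z.2)).
- move=> m n z mn; apply: is_pattern_subseq.
  by apply: cat_subseq; [|apply: cat_subseq]; rewrite ?subseq_nseq.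
- move=> m; have [l [r [lm rm plr]]] := pattern_pad (m * #|V|) pab.
  have [|u ul] := @seq_pigeonhole V a l m; first by rewrite lm.
  have [|v vr] := @seq_pigeonhole V a r m; first by rewrite rm.
  exists (u, v); apply: is_pattern_subseq plr.
  by apply: cat_subseq => //; apply: cat_subseq.
by exists u, v, a, b.
Qed.

(** In [pattern_core], either u and v differ and a and b can be erased, or one
    of a and b differs from u = v. *)
Lemma pattern_dichotomy :
  (exists u v, u != v /\ forall m, pat (nseq m u ++ nseq m v)) \/
  (exists u a K, [/\ u != a, forall m, pat (nseq m u ++ a :: nseq m u) &
     forall x y, x != y -> ~ pat (nseq K x ++ nseq K y)]).
Proof.
have [step|nstep] :=
  pselect (exists u v, u != v /\ forall m, pat (nseq m u ++ nseq m v)).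
  by left.
right; have [u [v [a [b [ab uvab]]]]] := pattern_core.
have uv : u = v.
  apply: contrapT => /eqP uv; apply: nstep; exists u, v; split=> // m.
  apply: is_pattern_subseq (uvab m); apply: cat_subseq => //.
  exact: suffix_subseq.
subst v.
have [c uc cP] : exists2 c, u != c & forall m, pat (nseq m u ++ c :: nseq m u).
  have [ua|ua] := eqVneq u a; last first.
    exists a => // m; apply: is_pattern_subseq (uvab m); apply: cat_subseq => //=.
    by rewrite eqxx; exact: (suffix_subseq [:: b]).
  exists b; first by rewrite ua.
  move=> m; apply: is_pattern_subseq (uvab m); apply: cat_subseq => //.
  exact: (suffix_subseq [:: a] (b :: nseq m u)).
have [K KP] : exists K, forall z : V * V, z.1 != z.2 ->
    ~ pat (nseq K z.1 ++ nseq K z.2).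
  apply: contrapT => /forallNP nK; apply: nstep.
  have [|n|z zP] := @ultra_antitone (V * V)%type
    (fun m z => z.1 != z.2 /\ pat (nseq m z.1 ++ nseq m z.2)).
  - move=> m n z mn [z12 pz]; split=> //; apply: is_pattern_subseq pz.
    by apply: cat_subseq; exact: subseq_nseq.
  - have /existsNP[z /not_implyP[z12 /contrapT pz]] := nK n.
    by exists z.
  - exists z.1, z.2; split; first by have [] := zP 0%N.
    by move=> m; have [] := zP m.
by exists u, c, K; split=> // x y; exact: (KP (x, y)).
Qed.

(** Let u be a value that recurs infinitely often. A value v taken more than K
    times, followed by K later occurrences of u, would give the
    pattern v^K u^K. *)
Lemma pattern_point_deviation K (p : pattern_point f U) :
  (forall x y, x != y -> ~ pat (nseq K x ++ nseq K y)) ->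
  exists u, forall v n, v != u -> (count_mem v (mkseq (sval p) n) <= K)%N.
Proof.
move=> noK; have [|u Uu] := @ultra_exists U UU V (fun u => [set i | sval p i = u]).
  by apply: filterE => i; exists (sval p i).
exists u => v n vu; rewrite leqNgt; apply/negP => Kv; apply: (noK _ _ vu).
have [|m Km] := @count_recurrent _ (sval p) u _ K n.
  by move=> k; have [i [pi ki]] := filter_ex (filterI Uu (U_ge k)); exists i.
apply: is_pattern_subseq (svalP p (n + m)%N); rewrite /mkseq iotaD map_cat.
apply: cat_subseq; apply: nseq_subseq; first exact: ltnW.
by rewrite add0n -[n]addn0 iotaDl -map_comp.
Qed.

End dichotomy.

(** * The spaces X_A *)

Lemma closed_span_valZ (R : realType) (V : completeNormedModType R)
    (S : set V) a (x : closed_span S) :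
  closed_span_val (a *: x) = a *: closed_span_val x.
Proof. exact: erefl. Qed.

Lemma linfty_evalZ (R : realType) (Omega : Type) a (g : linfty R Omega) w :
  (a *: g) w = a * g w.
Proof. exact: erefl. Qed.

Section XA_theory.
Context (R : realType) (Omega : Type) (A : set (Omega -> R)).
Implicit Types (x y : XA A) (w : Omega).

Definition XA_eval x w : R := (closed_span_val x : linfty R Omega) w.

Lemma XA_evalD x y w : XA_eval (x + y) w = XA_eval x w + XA_eval y w.
Proof. by []. Qed.

Lemma XA_evalZ a x w : XA_eval (a *: x) w = a * XA_eval x w.
Proof. by rewrite /XA_eval closed_span_valZ linfty_evalZ. Qed.

Lemma XA_evalB x y w : XA_eval (x - y) w = XA_eval x w - XA_eval y w.
Proof. by rewrite -scaleN1r XA_evalD XA_evalZ mulN1r. Qed.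

Lemma XA_eval_linear w : linear (XA_eval^~ w).
Proof. by move=> a x y; rewrite XA_evalD XA_evalZ. Qed.

Lemma le_XA_norm x w : `|XA_eval x w| <= `|x|.
Proof. exact: le_linfty_norm. Qed.

Lemma XA_norm_le x M : 0 <= M -> (forall w, `|XA_eval x w| <= M) -> `|x| <= M.
Proof. by move=> M0 xM; exact: linfty_norm_le. Qed.

Lemma XA_eval_sum w (I : Type) (s : seq I) (P : pred I) (F : I -> XA A) :
  XA_eval (\sum_(i <- s | P i) F i) w = \sum_(i <- s | P i) XA_eval (F i) w.
Proof. by elim/big_rec2 : _ => // i y z _ <-. Qed.

Lemma XA_eval_lincomb w n (b : 'I_n -> XA A) c :
  XA_eval (lincomb b c) w = \sum_(i < n) c i * XA_eval (b i) w.
Proof.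
rewrite /lincomb XA_eval_sum; apply: eq_bigr => i _; exact: XA_evalZ.
Qed.

Lemma XA_eval_dual w : XA_eval^~ w \in dual_pred (XA A).
Proof.
apply: (@bounded_dual _ _ _ 1); first exact: XA_eval_linear.
by move=> x; rewrite mul1r; exact: le_XA_norm.
Qed.

Lemma XA_mem (g : Omega -> R) : A g -> g \in @linfty_pred R Omega ->
  exists x, XA_eval x = g.
Proof.
move=> Ag bg.
have gP : Linfty bg \in closed_span_pred [set f : linfty R Omega | A f].
  by rewrite inE; apply: subset_closure; exact: sub_linear_span.
by exists (ClosedSpan gP).
Qed.

Lemma XA_dense (e : nat -> XA A) : A `<=` range (fun i => XA_eval (e i)) ->
  forall x eta, 0 < eta -> exists N, forall n, (N <= n)%N ->
  exists c, `|x - lincomb (fun i : 'I_n => e i) c| < eta.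
Proof.
move=> Ae x eta eta0.
have : closure (linear_span [set f : linfty R Omega | A f]) (val x).
  by have := valP x; rewrite inE.
move=> /(_ _ (nbhsx_ballx (val x) eta eta0))[z [[m [y [c [yA ->]]]] xz]].
have /choice[k kP] : forall l, exists i, y l = val (e i).
  by move=> l; have [i _ yl] := Ae _ (yA l); exists i; exact/val_inj.
exists (\max_(l < m) (k l).+1)%N => n kn.
have kln l : (k l < n)%N by apply: leq_trans kn; exact: leq_bigmax.
exists (fun i => \sum_(l < m) c l * (i == Ordinal (kln l))%:R).
rewrite -lincomb_sum (_ : (fun l => _) = e \o k); last first.
  by apply/funext => l; rewrite lincomb_unit.
move: xz; rewrite -ball_normE /=; congr (`|_| < _); congr (_ - _).
rewrite /lincomb (big_morph val (id1 := 0) (op1 := +%R)) //.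
by apply: eq_bigr => l _; rewrite kP.
Qed.

End XA_theory.

(** * Ladders *)

(** An ultrafilter pushes forward to an ultrafilter, so bounded real
    families converge along it. *)
Lemma ultra_bounded_cvg (R : realType) (T : Type) (U : set_system T)
    (a : T -> R) (M : R) : UltraFilter U -> (forall i, `|a i| <= M) ->
  exists l : R, a i @[i --> U] --> l.
Proof.
move=> UU aM.
have aU : UltraFilter (fmap a U).
  split=> [|G GG aG]; first exact: fmap_proper_filter.
  apply/seteqP; split=> // B GB.
  have [//|UnB] := in_ultra_setVsetC (a @^-1` B) UU.
  have nB : G (~` B) by apply: aG.
  by have [? []] := filter_ex (filterI GB nB).
have := @segment_compact R (- M) M; rewrite compact_ultra => /(_ _ aU).
case=> [|l [_ al]]; last by exists l.
by apply: (@filterE _ U) => i /=; rewrite in_itv /= -ler_norml.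
Qed.

(** The limits of g (x i) along the ultrafilter define an element of the bidual,
    a weak limit of the sequence. *)
Lemma reflexive_ultra_limit (R : realType) (X : completeNormedModType R)
    (U : set_system nat) (x : nat -> X) (M : R) : UltraFilter U ->
  reflexive_space X -> (forall i, `|x i| <= M) ->
  exists y, forall g : dual X, g (x i) @[i --> U] --> g y.
Proof.
move=> UU reflX xM.
have gx (g : dual X) i : `|g (x i)| <= `|g| * M.
  by apply: le_trans (dual_le g _) _; rewrite dual_normE ler_wpM2l // -dual_normE.
have /choice[L LP] : forall g : dual X, exists l : R, g (x i) @[i --> U] --> l.
  by move=> g; exact: ultra_bounded_cvg (gx g).
have Luniq (g : dual X) (l : R) : g (x i) @[i --> U] --> l -> L g = l.
  by move=> gl; rewrite -(cvg_lim (@Rhausdorff R) gl) (cvg_lim (@Rhausdorff R) (LP g)).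
have Ll : linear L.
  move=> a g h; apply: Luniq; apply: cvgD (LP h).
  exact: cvgZl_tmp (LP g).
have LM g : `|L g| <= M * `|g|.
  apply: (cvgr_to_le (cvg_norm (LP g))).
  by apply: filterE => i; rewrite mulrC.
have [y yL] := reflX (Dual (bounded_dual Ll LM)).
exists y => g.
have -> : g y = L g by rewrite -[RHS]/(Dual (bounded_dual Ll LM) g) -yL.
exact: LP.
Qed.

(** A weak limit y of the x_i along an ultrafilter has D_k y = beta for all k
    and Doo y = alpha. But every y is within |alpha - beta| / 3 of a
    finite combination of the e_i, at which D_k and Doo agree for large k. *)
Lemma ladder_not_reflexive (R : realType) (Y : completeNormedModType R)
    (e : nat -> Y) (x : nat -> Y) (D : nat -> dual Y) (Doo : dual Y)
    (alpha beta M : R) :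
  (forall y eta, 0 < eta -> exists n c,
      `|y - lincomb (fun i : 'I_n => e i) c| < eta) ->
  (forall k y, `|D k y| <= `|y|) -> (forall y, `|Doo y| <= `|y|) ->
  (forall i, \forall k \near \oo, D k (e i) = Doo (e i)) ->
  alpha != beta -> (forall i, `|x i| <= M) ->
  (forall i k, D k (x i) = if (i < k)%N then alpha else beta) ->
  (forall i, Doo (x i) = alpha) ->
  ~ reflexive_space Y.
Proof.
move=> dense D1 Doo1 De ab xM Dx Doox reflY.
have [U [UU Uoo]] := ultraFilterLemma eventually_filter.
have [y yP] := reflexive_ultra_limit UU reflY xM.
have Dy k : D k y = beta.
  have := cvg_unique _ (yP (D k)); apply => //.
  apply: cvg_near_cst; apply: Uoo; exists k => // i /= ki.
  by rewrite Dx ltnNge ki.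
have Dooy : Doo y = alpha.
  have := cvg_unique _ (yP Doo); apply => //.
  by apply: cvg_near_cst; apply: filterE => i; rewrite Doox.
pose eta := `|alpha - beta| / 3.
have eta0 : 0 < eta by rewrite divr_gt0 // normr_gt0 subr_eq0.
have [n [c yc]] := dense y eta eta0.
set z := lincomb _ _ in yc.
have [k kP] : exists k, forall i : 'I_n, D k (e i) = Doo (e i).
  by have := filter_forall eventually_filter (fun i : 'I_n => De i) => /filter_ex.
have Dz : D k z = Doo z.
  by rewrite !dual_lincomb; apply: eq_bigr => i _; rewrite kP.
have dualB (g : dual Y) u v : g (u - v) = g u - g v.
  by rewrite -scaleN1r addrC dual_linear scaleN1r addrC.
have := D1 k (y - z); have := Doo1 (y - z); rewrite !dualB Dy Dooy Dz.
have := normr_ge0 (alpha - beta).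
have := ler_distD (Doo z) alpha beta; rewrite (distrC (Doo z)).
by rewrite /eta in yc; lra.
Qed.

Section ladder_trees.
Context (R : realType).

Definition block_weight j i (l : nat) : R :=
  2^-1 ^+ j * ((i <= l)%N && (l < i + 2 ^ j)%N)%:R.

Lemma block_weight_ge0 j i l : 0 <= block_weight j i l.
Proof. by rewrite mulr_ge0 // exprn_ge0 // invr_ge0. Qed.

Lemma block_mean_lincomb (V : lmodType R) m (b : 'I_m -> V) (x : nat -> V)
    j i : (forall l : 'I_m, x l = b l) -> (i + 2 ^ j <= m)%N ->
  block_mean j x i = lincomb b (fun l => block_weight j i l).
Proof.
move=> xb im; rewrite /block_mean (big_nat_widenl _ 0) // (big_nat_widen _ _ m) //.
rewrite big_mkord scaler_sumr big_mkcond; apply: eq_bigr => l _.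
rewrite /block_weight /= xb; case: ifP => _; first by rewrite mulr1.
by rewrite mulr0 scale0r.
Qed.

Lemma block_weight_sum m j i : (i + 2 ^ j <= m)%N ->
  \sum_(l < m) block_weight j i l = 1.
Proof.
move=> im; have := @block_mean_lincomb R^o m (fun=> 1) (fun=> 1) j i (fun=> erefl) im.
rewrite /lincomb; under eq_bigr do rewrite [_ *: _]mulr1.
move=> <-; rewrite /block_mean sumr_const_nat addKn.
transitivity (2^-1 ^+ j * (2 ^ j)%:R : R); first by [].
by rewrite natrX exprVn mulVf // expf_neq0.
Qed.

(** On a ladder the functional at the boundary of two consecutive blocks takes
    the value alpha at the mean of the left one and beta at the mean of the
    right one: the block means form separated dyadic trees of any height. *)
Lemma ladder_not_uniformly_convex (Y X : normedModType R)
    (x : nat -> Y) (D : nat -> dual Y) (alpha beta M : R) :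
  has_almost_isometric_copies Y X ->
  (forall k y, `|D k y| <= `|y|) ->
  alpha != beta -> (forall i, `|x i| <= M) ->
  (forall i k, D k (x i) = if (i < k)%N then alpha else beta) ->
  forall N : X -> R, equivalent_norm N -> ~ uniformly_convex N.
Proof.
move=> copies D1 ab xM Dx N [N_norm [c [C [c0 C0 cNC]]]] N_uc.
set g := `|alpha - beta|.
have g0 : 0 < g by rewrite normr_gt0 subr_eq0.
have theta0 : 0 < c * (g / 2) by rewrite mulr_gt0 // divr_gt0.
have [n nP] := uniformly_convex_no_tree N_norm N_uc (C * (M + 1)) theta0.
(* The coefficients of a difference of two block means have l^1 norm 2, so an
   error of g / 4 per unit leaves half of the separation g. *)
pose eta := Num.min 1 (g / 4).
have eta0 : 0 < eta by rewrite lt_min ltr01 divr_gt0.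
have eta1 : eta <= 1 by rewrite ge_min lexx.
have eta4 : eta <= g / 4 by rewrite ge_min lexx orbT.
have [z' z'P] := copies (2 ^ n)%N (fun l => x l) eta eta0.
pose z l := oapp z' 0 (insub l).
have zz' (l : 'I_(2 ^ n)) : z l = z' l by rewrite /z valK.
apply: (nP z) => [l ln|j i ijn].
  rewrite -[l]/(nat_of_ord (Ordinal ln)) zz'.
  have /andP[_] := cNC (z' (Ordinal ln)); move/le_trans; apply.
  rewrite ler_pM2l //.
  have := z'P (fun l => (l == Ordinal ln)%:R); rewrite !lincomb_unit.
  rewrite (bigD1 (Ordinal ln)) //= eqxx normr1 big1; last first.
    by move=> k /negPf ->; rewrite normr0.
  rewrite addr0 mulr1 ler_norml => /andP[_].
  by have := xM l; lra.
have ijn2 : (i + 2 ^ j + 2 ^ j <= 2 ^ n)%N.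
  by rewrite -addnA addnn -mul2n -expnS.
have ijn1 : (i + 2 ^ j <= 2 ^ n)%N := leq_trans (leq_addr _ _) ijn2.
rewrite !(block_mean_lincomb zz') // -lincombB.
set t := fun l : 'I_(2 ^ n) => _.
have /andP[cN _] := cNC (lincomb z' t); apply: le_trans cN.
rewrite ler_pM2l //.
have t2 : \sum_(l < 2 ^ n) `|t l| <= 2.
  rewrite -[2]/(1 + 1) -{1}(block_weight_sum ijn1) -(block_weight_sum ijn2).
  rewrite -big_split /=; apply: ler_sum => l _.
  apply: le_trans (ler_normB _ _) _.
  by rewrite !ger0_norm ?block_weight_ge0.
have Dt : D (i + 2 ^ j)%N (lincomb (fun l : 'I_(2 ^ n) => x l) t) = alpha - beta.
  rewrite dual_lincomb /t; under eq_bigr do rewrite mulrBl.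
  rewrite sumrB; congr (_ - _).
    rewrite -[RHS]mul1r -(block_weight_sum ijn1) mulr_suml.
    apply: eq_bigr => l _; rewrite Dx /block_weight.
    by case: (l < _)%N; rewrite ?andbF ?mulr0 ?mul0r.
  rewrite -[RHS]mul1r -(block_weight_sum ijn2) mulr_suml.
  apply: eq_bigr => l _; rewrite Dx ltnNge /block_weight.
  by case: (_ <= l)%N; rewrite ?mulr0 ?mul0r.
have gt : g <= `|lincomb (fun l : 'I_(2 ^ n) => x l) t| by rewrite /g -Dt.
have et : eta * \sum_(l < 2 ^ n) `|t l| <= g / 4 * 2.
  by rewrite ler_pM // ?(ltW eta0) // sumr_ge0.
have := z'P t; rewrite ler_norml => /andP[+ _].
by lra.
Qed.

End ladder_trees.

(** * The pattern space *)

Lemma mkseq_prefix (T : Type) (u : T) (g : nat -> T) k n :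
  mkseq (fun i => if (i < k)%N then u else g (i - k)%N) (k + n) =
  nseq k u ++ mkseq g n.
Proof.
apply: (@eq_from_nth _ u) => [|i].
  by rewrite size_cat size_nseq !size_mkseq.
rewrite size_mkseq => ikn; rewrite nth_mkseq // nth_cat size_nseq nth_nseq.
by case: ltnP => // ki; rewrite nth_mkseq // ltn_subLR.
Qed.

Lemma mkseq_cst (T : Type) (u : T) n : mkseq (fun=> u) n = nseq n u.
Proof.
by apply: (@eq_from_nth _ u) => [|i];
  rewrite size_mkseq ?size_nseq // => ni; rewrite nth_mkseq // nth_nseq ni.
Qed.

Section pattern_space.
Context (R : realType) (Omega : Type) (V : finType) (f : nat -> Omega -> V).
Context (U : set_system nat) {UU : UltraFilter U} (Uoo : \oo `<=` U).
Hypothesis f_distinct : forall i j, i != j -> exists w, f i w != f j w.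
Context (r : V -> R) (r_inj : injective r).
Context (A : set (Omega -> R)) (Af : forall i, A (fun w => r (f i w))).

Local Notation Omega' := (pattern_point f U).

(** A spreading model of the functions r (f i), realised concretely: the
    coordinates are its fundamental sequence. *)
Definition pattern_space : completeNormedModType R :=
  XA (range (fun i (p : Omega') => r (sval p i))).

Let B := \sum_v `|r v|.

Let rB v : `|r v| <= B.
Proof. by rewrite /B (bigD1 v) //= lerDl sumr_ge0. Qed.

Let B_ge0 : 0 <= B. Proof. exact: sumr_ge0. Qed.

Let bounded_fun T (g : T -> V) : (fun w => r (g w)) \in @linfty_pred R T.
Proof. by rewrite inE; exists B. Qed.

Lemma pattern_space_generators : exists e : nat -> pattern_space,
  forall i p, XA_eval (e i) p = r (sval p i).
Proof.
have /choice[e eE] : forall i, exists e : pattern_space,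
    forall p, XA_eval e p = r (sval p i).
  move=> i; have [||e eE] := @XA_mem R Omega'
    (range (fun i (p : Omega') => r (sval p i))) (fun p => r (sval p i)).
  - by exists i.
  - exact: bounded_fun.
  - by exists e => p; rewrite eE.
by exists e.
Qed.

Lemma family_in_XA : exists h : nat -> XA A,
  forall i w, XA_eval (h i) w = r (f i w).
Proof.
have /choice[h hE] : forall i, exists h : XA A,
    forall w, XA_eval h w = r (f i w).
  move=> i; have [|h hE] := @XA_mem R Omega A (fun w => r (f i w)) (Af i).
    exact: bounded_fun.
  by exists h => w; rewrite hE.
by exists h.
Qed.

Context (e : nat -> pattern_space).
Hypothesis eE : forall i p, XA_eval (e i) p = r (sval p i).

(** The norm on either side is the greatest absolute value of a linear form in
    n variables over the same finite set of value vectors: the patterns of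
    length n. *)
Lemma pattern_space_isometric_copies n : exists k : 'I_n -> XA A,
  forall c, `|lincomb k c| = `|lincomb (fun i : 'I_n => e i) c|.
Proof.
have [h hE] := family_in_XA.
have [x [xn xP]] := @pattern_realized Omega V f U UU n unit (fun=> setT).
exists (fun i => h (nth 0%N x i)) => c.
apply/eqP; rewrite eq_le; apply/andP; split.
  apply: XA_norm_le => // w; rewrite XA_eval_lincomb.
  have sn : size [seq f i w | i <- x] == n by rewrite size_map xn.
  have [p pP] := @pattern_point_extend _ _ f U UU [seq f i w | i <- x]
    ((xP tt (Tuple sn)).2 (ex_intro _ w (conj I erefl))).
  apply: le_trans (le_XA_norm _ p); rewrite XA_eval_lincomb.
  rewrite (eq_bigr (fun i : 'I_n => c i * XA_eval (e i) p)) // => i _.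
  rewrite hE eE; congr (c i * r _).
  rewrite -(nth_map _ (f 0%N w) (fun j => f j w)) ?xn // -pP nth_mkseq //.
  by rewrite size_map xn.
apply: XA_norm_le => // p; rewrite XA_eval_lincomb.
have sn : size (mkseq (sval p) n) == n by rewrite size_mkseq.
have [w [_ wP]] := (xP tt (Tuple sn)).1 (svalP p n).
apply: le_trans (le_XA_norm _ w); rewrite XA_eval_lincomb.
rewrite (eq_bigr (fun i : 'I_n => c i * XA_eval (h (nth 0%N x i)) w)) // => i _.
rewrite hE eE; congr (c i * r _).
by rewrite -(nth_map _ (f 0%N w) (fun j => f j w)) ?xn // wP /= nth_mkseq.
Qed.

Lemma pattern_space_dense (y : pattern_space) eta : 0 < eta ->
  exists N, forall n, (N <= n)%N ->
  exists c, `|y - lincomb (fun i : 'I_n => e i) c| < eta.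
Proof.
apply: XA_dense => _ [i _ <-]; exists i => //.
by apply/funext => p; rewrite eE.
Qed.

(** By density, finite families of the pattern space are nearly contained in
    the span of finitely many generators. *)
Lemma pattern_space_copies :
  has_almost_isometric_copies pattern_space (XA A).
Proof.
move=> d b eta eta0.
have /choice[N NP] := fun i => pattern_space_dense (b i) eta0.
pose n := (\max_(i < d) N i)%N.
have /choice[C CP] : forall i, exists c,
    `|b i - lincomb (fun i : 'I_n => e i) c| < eta.
  by move=> i; apply: (NP i); exact: leq_bigmax.
have [k kP] := pattern_space_isometric_copies n.
exists (fun i => lincomb k (C i)) => c.
rewrite lincomb_sum kP -lincomb_sum.
apply: le_trans (ler_dist_dist _ _) _.
rewrite /lincomb -sumrB mulr_sumr; apply: le_trans (ler_norm_sum _ _ _) _.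
apply: ler_sum => i _; rewrite -scalerBr normrZ mulrC ler_wpM2r //.
by rewrite distrC; apply: ltW; exact: CP.
Qed.

Lemma pattern_point_of_prefixes (p : nat -> V) (k : nat) :
  (forall n, is_pattern f U (mkseq p (k + n)%N)) ->
  exists q : Omega', sval q = p.
Proof.
move=> pP; suff pP' n : is_pattern f U (mkseq p n) by exists (exist _ p pP').
apply: is_pattern_subseq (pP n); rewrite /mkseq addnC iotaD map_cat.
exact: prefix_subseq.
Qed.

(** The jump of the values at w k from alpha to beta is at odds with weak
    compactness because the w k converge coordinatewise to woo. *)
Definition is_ladder (x : nat -> pattern_space) (w : nat -> Omega')
    (woo : Omega') (alpha beta M : R) :=
  [/\ alpha != beta, forall i, `|x i| <= M,
      forall i k, XA_eval (x i) (w k) = if (i < k)%N then alpha else beta,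
      forall i, XA_eval (x i) woo = alpha &
      forall i k, (i < k)%N -> sval (w k) i = sval woo i].

(** The words u^k v^oo converge to u^oo, and the generators form a ladder. *)
Lemma step_ladder u v : u != v ->
  (forall m, is_pattern f U (nseq m u ++ nseq m v)) ->
  exists x w woo alpha beta M, is_ladder x w woo alpha beta M.
Proof.
move=> uv step.
have /choice[w wE] : forall k, exists q : Omega',
    sval q = fun i => if (i < k)%N then u else v.
  move=> k; apply: (@pattern_point_of_prefixes _ k) => n.
  rewrite (mkseq_prefix u (fun=> v)) mkseq_cst.
  apply: is_pattern_subseq (step (k + n)%N).
  by apply: cat_subseq; apply: subseq_nseq; rewrite ?leq_addr ?leq_addl.
have [woo wooE] : exists q : Omega', sval q = fun=> u.
  apply: (@pattern_point_of_prefixes _ 0%N) => n; rewrite mkseq_cst.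
  by apply: is_pattern_subseq (step n); exact: prefix_subseq.
exists e, w, woo, (r u), (r v), B; split.
- by rewrite (inj_eq r_inj).
- by move=> i; apply: XA_norm_le => // q; rewrite eE.
- by move=> i k; rewrite eE wE; case: ifP.
- by move=> i; rewrite eE wooE.
- by move=> i k ik; rewrite wE wooE ik.
Qed.

Lemma alternating_sum_le (a : nat -> R) t m :
  `|\sum_(j < m) (a j.*2 - a j.*2.+1)| <= \sum_(i < m.*2) `|a i - t|.
Proof.
elim: m => [|m IH]; first by rewrite !big_ord0 normr0.
rewrite doubleS !big_ord_recr /= -addrA.
apply: le_trans (ler_normD _ _) _; rewrite lerD //.
have -> : a m.*2 - a m.*2.+1 = (a m.*2 - t) - (a m.*2.+1 - t).
  by rewrite opprB addrA subrK.
exact: ler_normB.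
Qed.

Lemma deviation_sum K u (p : Omega') n :
  (forall v, v != u -> (count_mem v (mkseq (sval p) n) <= K)%N) ->
  \sum_(i < n) `|r (sval p i) - r u| <= \sum_(v : V) K%:R * (B + B).
Proof.
move=> dev.
rewrite -(big_mkord xpredT (fun i => `|r (sval p i) - r u|)).
rewrite /index_iota subn0 -(big_map (sval p) xpredT (fun v => `|r v - r u|)).
rewrite (partition_big id xpredT) //=; apply: ler_sum => v _.
rewrite (eq_bigr (fun=> `|r v - r u|)); last by move=> i /eqP ->.
have [->|vu] := eqVneq v u.
  by rewrite subrr normr0 big1 // mulr_ge0 ?addr_ge0.
rewrite big_const_seq iter_addr_0 -[X in X <= _]mulr_natl.
by rewrite ler_pM // ?ler_nat ?dev // (le_trans (ler_normB _ _)) // lerD.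
Qed.

(** The words u^(2k) a u^oo converge to u^oo, and the partial sums of the
    differences e_(2j) - e_(2j+1) form a ladder, since the k-th word only
    charges the k-th difference. They are bounded because every point deviates
    boundedly often from some constant, which drops out of the differences. *)
Lemma spike_ladder u a K : u != a ->
  (forall m, is_pattern f U (nseq m u ++ a :: nseq m u)) ->
  (forall x y, x != y -> ~ is_pattern f U (nseq K x ++ nseq K y)) ->
  exists x w woo alpha beta M, is_ladder x w woo alpha beta M.
Proof.
move=> ua spike noK.
have /choice[w wE] : forall k, exists q : Omega',
    sval q = fun i => if i == k.*2 then a else u.
  move=> k; apply: (@pattern_point_of_prefixes _ k.*2) => n.
  have -> : (fun i => if i == k.*2 then a else u) = fun i =>
      if (i < k.*2)%N then u else (fun i => if i is 0%N then a else u) (i - k.*2)%N.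
    apply/funext => i; case: (ltngtP i k.*2) => [//|ki|->]; last by rewrite subnn.
    by rewrite -subn_gt0 in ki; case: (i - k.*2)%N ki.
  rewrite (mkseq_prefix u (fun i => if i is 0%N then a else u)).
  apply: is_pattern_subseq (spike (k.*2 + n)%N); apply: cat_subseq.
    by apply: subseq_nseq; rewrite leq_addr.
  case: n => [|n]; first exact: sub0seq.
  have -> : mkseq (fun i => if i is 0%N then a else u) n.+1 = a :: nseq n u.
    by rewrite /mkseq /= -[1%N]addn0 iotaDl -map_comp -(mkseq_cst u).
  rewrite /= eqxx; apply: subseq_nseq; by rewrite addnS ltnW // ltnS leq_addl.
have [woo wooE] : exists q : Omega', sval q = fun=> u.
  apply: (@pattern_point_of_prefixes _ 0%N) => n; rewrite mkseq_cst.
  by apply: is_pattern_subseq (spike n); exact: prefix_subseq.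
pose x i := \sum_(j < i.+1) (e j.*2 - e j.*2.+1).
have xE i p : XA_eval (x i) p =
    \sum_(j < i.+1) (r (sval p j.*2) - r (sval p j.*2.+1)).
  by rewrite XA_eval_sum; apply: eq_bigr => j _; rewrite XA_evalB !eE.
exists x, w, woo, 0, (r a - r u), (\sum_(v : V) K%:R * (B + B)); split.
- by rewrite eq_sym subr_eq0 (inj_eq r_inj) eq_sym.
- move=> i; apply: XA_norm_le => [|p].
    by apply: sumr_ge0 => v _; rewrite mulr_ge0 ?addr_ge0.
  rewrite xE; have [v vP] := pattern_point_deviation Uoo p noK.
  apply: le_trans (alternating_sum_le (fun j => r (sval p j)) (r v) i.+1) _.
  by apply: deviation_sum => y yv; exact: vP.
- move=> i k; rewrite xE wE.
  have termE j : r (if j.*2 == k.*2 then a else u) -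
      r (if j.*2.+1 == k.*2 then a else u) = if j == k then r a - r u else 0.
    have -> : (j.*2.+1 == k.*2) = false.
      by apply/eqP => /(congr1 odd); rewrite /= !odd_double.
    by rewrite (inj_eq double_inj); case: eqP => _ //; rewrite subrr.
  case: ltnP => [ik|ki].
    rewrite big1 // => j _; rewrite termE ifN // neq_ltn.
    by rewrite (leq_trans (ltn_ord j) ik).
  rewrite (bigD1 (Ordinal (ki : (k < i.+1)%N))) //= termE eqxx big1 ?addr0 //.
  by move=> j jk; rewrite termE ifN.
- by move=> i; rewrite xE wooE big1 // => j _; rewrite subrr.
- move=> i k ik; rewrite wE wooE ifN // neq_ltn (leq_trans ik) //.
  by rewrite -addnn leq_addr.
Qed.

Lemma pattern_space_ladder :
  exists (x : nat -> pattern_space) (w : nat -> Omega') (woo : Omega')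
         (alpha beta M : R),
  is_ladder x w woo alpha beta M.
Proof.
have [[u [v [uv step]]]|[u [a [K [ua spike noK]]]]] :=
  pattern_dichotomy Uoo f_distinct.
- exact: step_ladder uv step.
- exact: spike_ladder ua spike noK.
Qed.

End pattern_space.

(** * The equivalences *)

(** Recording the values in a finite type separates the combinatorics of the
    family from the real numbers. *)
Lemma infinite_family (R : realType) (Omega : Type) (F : set R)
    (A : set (Omega -> R)) : finite_set F ->
  A `<=` [set f | forall w, F (f w)] -> infinite_set A ->
  exists (V : finType) (r : V -> R) (f : nat -> Omega -> V),
    [/\ injective r, forall i, A (fun w => r (f i w)) &
        forall i j, i != j -> exists w, f i w != f j w].
Proof.
move=> /finite_seqP[s ->] As /infiniteP/pcard_leP/injfunPex[g gA g_inj].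
have gs i w : g i w \in s by apply: As; exact: gA.
exists (seq_sub s), (@ssval _ s), (fun i w => SeqSub (gs i w)); split.
- exact: val_inj.
- by move=> i; exact: gA.
- move=> i j ij; apply: contrapT => /forallNP fij.
  move/eqP : ij; apply; apply: g_inj; rewrite ?inE //.
  apply/funext => w; have /negP := fij w; rewrite negbK => /eqP.
  by move=> /(congr1 (@ssval _ s)).
Qed.

(** The non-reflexive space is the pattern space of a sequence in A. *)
Lemma infinite_ladder_space (R : realType) (Omega : Type) (F : set R)
    (A : set (Omega -> R)) : finite_set F ->
  A `<=` [set f | forall w, F (f w)] -> infinite_set A ->
  (exists2 Y : completeNormedModType R, finitely_representable Y (XA A) &
     ~ reflexive_space Y) /\
  (forall N : XA A -> R, equivalent_norm N -> ~ uniformly_convex N).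
Proof.
move=> finF AF infA.
have [V [r [f [r_inj Af f_distinct]]]] := infinite_family finF AF infA.
have [U [UU Uoo]] := ultraFilterLemma eventually_filter.
have [e eE] := @pattern_space_generators R Omega V f U r.
have [x [w [woo [al [be [M [ab xM xw xwoo wwoo]]]]]]] :=
  pattern_space_ladder Uoo f_distinct r_inj eE.
have copies := @pattern_space_copies R Omega V f U UU r A Af e eE.
pose E := range (fun i (p : pattern_point f U) => r (sval p i)).
pose D k := Dual (XA_eval_dual E (w k)).
pose Doo := Dual (XA_eval_dual E woo).
split; last first.
  apply: (@ladder_not_uniformly_convex R (pattern_space f U r) (XA A)
    x D al be M) => //.
  by move=> k y; exact: le_XA_norm.
exists (pattern_space f U r).
  exact: almost_isometric_copies_finitely_representable.
apply: (@ladder_not_reflexive R (pattern_space f U r) e x D Doo al be M) => //.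
- move=> y eta eta0; have [n nP] := pattern_space_dense eE y eta0.
  by exists n; exact: nP.
- by move=> k y; exact: le_XA_norm.
- by move=> y; exact: le_XA_norm.
- by move=> i; exists i.+1 => // k ik; rewrite /= !eE wwoo.
Qed.

(** The span is closed, so it is all of X_A. *)
Lemma finite_set_XA (R : realType) (Omega : Type) (A : set (Omega -> R)) :
  finite_set A -> finite_dimensional [set: XA A].
Proof.
move=> finA.
pose S := [set f : linfty R Omega | A f].
have finS : finite_set S.
  by apply: finite_preimage finA => f g _ _; exact: val_inj.
have clS : closed (linear_span S).
  by apply: finite_dimensional_closed; exists S.
have spanS (x : XA A) : linear_span S (val x).
  rewrite ((closure_id (linear_span S)).1 clS).
  by have := valP x; rewrite inE.
exists [set x : XA A | S (val x)]; split.
  by apply: finite_preimage finS => x y _ _; exact: val_inj.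
apply/seteqP; split=> // x _; have [n [y [c [yS xE]]]] := spanS x.
have yP i : y i \in closed_span_pred S.
  by rewrite inE; apply: subset_closure; exact: sub_linear_span.
exists n, (fun i => ClosedSpan (yP i)), c; split => //.
apply: val_inj; rewrite xE; apply/esym.
by elim/big_rec2 : _ => // i u v _ <-.
Qed.

Theorem theorem3p1 (R : realType) (Omega : Type) (F : set R)
    (A : set (Omega -> R)) (finF : finite_set F)
    (AF : A `<=` [set f | forall w, F (f w)]) :
  [<-> finite_set A;
       finite_dimensional [set: XA A];
       superreflexive (XA A);
       exists N : XA A -> R, equivalent_norm N /\ uniformly_convex N] /\
  (infinite_set A ->
     ~ (~ finite_dimensional [set: XA A] /\ superreflexive (XA A))).
Proof.
have sr_finite : superreflexive (XA A) -> finite_set A.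
  move=> srA; apply: contrapT => infA.
  have [[Y YA nreflY] _] := infinite_ladder_space finF AF infA.
  exact: nreflY (srA Y YA).
split; last by move=> infA [_ /sr_finite].
tfae.
- exact: finite_set_XA.
- move=> fdA Y /finitely_representable_finite_dimensional/(_ fdA).
  exact: finite_dimensional_reflexive.
- move=> /sr_finite/finite_set_XA; exact: finite_dimensional_uniformly_convex.
- move=> [N [N_eq N_uc]]; apply: contrapT => infA.
  by have [_ /(_ N N_eq)] := infinite_ladder_space finF AF infA.
Qed.
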